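(* Let $e$ be a resource expression with $e\asymp e$ and let $e'\in\mathrm{supp}(\mathrm{NF}(e))$. Then $(\mathrm{NF}(e))_{e'}=\dfrac{m(e)}{m(e')}$.
   Context: Resource terms and monomials: $s,t ::= x\mid\lambda x.s\mid\langle s\rangle\bar t\mid s\oplus\bullet\mid\bullet\oplus s$, $\bar t::=[t_1,\dots,t_n]$ (finite multisets), up to $\alpha$-equivalence; a resource expression is a term or monomial. Finite formal sums with coefficients in $\mathbb N$; $E_e$ is the coefficient of $e$ and $\mathrm{supp}(E)$ the support; constructors extended by multilinearity. For $\bar u=[u_1,\dots,u_n]$, $\partial_xe\cdot\bar u$: $\partial_xy\cdot\bar u$ is $y$ if $y\ne x$ and $n=0$, $u_1$ if $y=x$ and $n=1$, $0$ otherwise; it commutes with $\lambda y.$ ($y$ fresh), $-\oplus\bullet$, $\bullet\oplus-$; $\partial_x(\langle s\rangle\bar t)\cdot\bar u=\sum_{(I_1,I_2)}\langle\partial_xs\cdot\bar u_{I_1}\rangle(\partial_x\bar t\cdot\bar u_{I_2})$; $\partial_x[t_1,\dots,t_k]\cdot\bar u=\sum_{(I_1,\dots,I_k)}[\partial_xt_1\cdot\bar u_{I_1},\dots,\partial_xt_k\cdot\bar u_{I_k}]$, sums over tuples of pairwise disjoint possibly empty subsets of $\{1,\dots,n\}$ covering it, $\bar u_I=[u_i\mid i\in I]$. The reduction $\to_\partial$ is generated by $\langle\lambda x.s\rangle\bar t\to_\partial\partial_xs\cdot\bar t$, $\langle s\oplus\bullet\rangle\bar t\to_\partial(\langle s\rangle\bar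 t)\oplus\bullet$, $\langle\bullet\oplus s\rangle\bar t\to_\partial\bullet\oplus\langle s\rangle\bar t$, $\lambda x.(s\oplus\bullet)\to_\partial(\lambda x.s)\oplus\bullet$, $\lambda x.(\bullet\oplus s)\to_\partial\bullet\oplus\lambda x.s$, closed under all contexts and extended to sums by $e+F\to_\partial E'+F$ when $e\to_\partial E'$; it is confluent and strongly normalizing and $\mathrm{NF}(E)$ is the normal form. Coherence $\asymp$: $x\asymp x$; $\lambda x.s\asymp\lambda x.s'$ if $s\asymp s'$; $\langle s\rangle\bar t\asymp\langle s'\rangle\bar t'$ if $s\asymp s'$ and $\bar t\asymp\bar t'$; $[t_1,\dots,t_n]\asymp[t_{n+1},\dots,t_{n+m}]$ if $t_i\asymp t_j$ for all $1\le i,j\le n+m$; $s\oplus\bullet\asymp s'\oplus\bullet$ and $\bullet\oplus s\asymp\bullet\oplus s'$ if $s\asymp s'$; $s\oplus\bullet\asymp\bullet\oplus s'$ for all $s,s'$ (symmetric). The multiplicity: $m(x)=1$; $m(\lambda x.s)=m(s\oplus\bullet)=m(\bullet\oplus s)=m(s)$; $m(\langle s\rangle\bar t)=m(s)m(\bar t)$; $m([t_1]^{n_1}\cdot\ldots\cdot[t_k]^{n_k})=\prod_{i=1}^kn_i!\,m(t_i)^{n_i}$ for pairwise distinct $t_i$ ($[t]^n$ is the multiset with $n$ copies of $t$, $\cdot$ is multiset union). *)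

(* Defs.v *)
From Stdlib Require Import Relations ClassicalEpsilon.
From HB Require Import structures.
From mathcomp Require Import all_boot all_order all_algebra.
From mathcomp Require Import zify.

Set Implicit Arguments.
Unset Strict Implicit.
Unset Printing Implicit Defensive.

(* Resource terms are written with de Bruijn indices, which takes care of     *)
(* alpha-equivalence, and with monomials presented as lists.  The equality of *)
(* resource expressions, i.e., up to the order of the elements of every       *)
(* nested monomial, is [canon _ = canon _] below.                             *)
Inductive rterm : Type :=
| Var of nat
| Lam of rterm
| App of rterm & seq rterm
| Inl of rterm (* s ⊕ • *)
| Inr of rterm (* • ⊕ s *).

Fixpoint rterm_nested_ind (P : rterm -> Prop)
    (PVar : forall x, P (Var x))
    (PLam : forall s, P s -> P (Lam s))
    (PApp : forall s ts, P s -> foldr (fun t => and (P t)) True ts ->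
       P (App s ts))
    (PInl : forall s, P s -> P (Inl s))
    (PInr : forall s, P s -> P (Inr s)) (t : rterm) : P t :=
  let ind := rterm_nested_ind PVar PLam PApp PInl PInr in
  match t with
  | Var x => PVar x
  | Lam s => PLam s (ind s)
  | App s ts => PApp s ts (ind s)
      ((fix inds ts : foldr (fun t => and (P t)) True ts :=
          match ts with
          | [::] => I
          | t :: ts' => conj (ind t) (inds ts')
          end) ts)
  | Inl s => PInl s (ind s)
  | Inr s => PInr s (ind s)
  end.

Fixpoint rterm_encode (t : rterm) : GenTree.tree nat :=
  match t with
  | Var x => GenTree.Leaf x
  | Lam s => GenTree.Node 0 [:: rterm_encode s]
  | App s ts => GenTree.Node 1 (rterm_encode s :: map rterm_encode ts)
  | Inl s => GenTree.Node 2 [:: rterm_encode s]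
  | Inr s => GenTree.Node 3 [:: rterm_encode s]
  end.

Fixpoint rterm_decode (c : GenTree.tree nat) : rterm :=
  match c with
  | GenTree.Leaf x => Var x
  | GenTree.Node 0 [:: c1] => Lam (rterm_decode c1)
  | GenTree.Node 1 (c1 :: cs) => App (rterm_decode c1) (map rterm_decode cs)
  | GenTree.Node 2 [:: c1] => Inl (rterm_decode c1)
  | GenTree.Node 3 [:: c1] => Inr (rterm_decode c1)
  | _ => Var 0
  end.

Lemma rterm_encodeK : cancel rterm_encode rterm_decode.
Proof.
elim/rterm_nested_ind => //= [s -> //|s ts -> IH|s -> //|s -> //].
by congr App; elim: ts IH => //= t ts IHts [-> /IHts ->].
Qed.

HB.instance Definition _ := Countable.copy rterm (can_type rterm_encodeK).

Lemma rterm_ind_in (P : rterm -> Prop) :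
    (forall x, P (Var x)) ->
    (forall s, P s -> P (Lam s)) ->
    (forall s ts, P s -> (forall t, t \in ts -> P t) -> P (App s ts)) ->
    (forall s, P s -> P (Inl s)) ->
    (forall s, P s -> P (Inr s)) ->
  forall t, P t.
Proof.
move=> PVar PLam PApp PInl PInr; elim/rterm_nested_ind => // s ts Ps Pts.
apply: PApp => // t; elim: ts Pts => //= u ts IH [Pu Pts].
by rewrite inE => /predU1P[-> //|]; apply: IH.
Qed.

(* A resource expression is a term or a monomial.                             *)
Inductive rexpr : Type := ETerm of rterm | EBag of seq rterm.

Definition rexpr_encode (e : rexpr) : rterm + seq rterm :=
  match e with ETerm t => inl t | EBag ts => inr ts end.

Definition rexpr_decode (c : rterm + seq rterm) : rexpr :=
  match c with inl t => ETerm t | inr ts => EBag ts end.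

Lemma rexpr_encodeK : cancel rexpr_encode rexpr_decode.
Proof. by case. Qed.

HB.instance Definition _ := Countable.copy rexpr (can_type rexpr_encodeK).

(* [choose (perm_eq ts) ts] depends only on the multiset of elements of ts.   *)
Definition canon_bag (ts : seq rterm) : seq rterm := choose (perm_eq ts) ts.

Fixpoint canon (t : rterm) : rterm :=
  match t with
  | Var x => Var x
  | Lam s => Lam (canon s)
  | App s ts => App (canon s) (canon_bag (map canon ts))
  | Inl s => Inl (canon s)
  | Inr s => Inr (canon s)
  end.

Definition canon_expr (e : rexpr) : rexpr :=
  match e with
  | ETerm t => ETerm (canon t)
  | EBag ts => EBag (canon_bag (map canon ts))
  end.

Lemma perm_canon_bag ts : perm_eq ts (canon_bag ts).
Proof. exact: (chooseP (perm_refl ts)). Qed.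

Lemma canon_bagP ts ts' :
  reflect (canon_bag ts = canon_bag ts') (perm_eq ts ts').
Proof.
apply: (iffP idP) => [eq_ts|eq_ts]; last first.
  by rewrite (perm_trans (perm_canon_bag ts)) // eq_ts perm_sym perm_canon_bag.
rewrite /canon_bag -(@eq_choose _ (perm_eq ts)); last first.
  by move=> x; apply: (permPl eq_ts).
exact: choose_id.
Qed.

Lemma canon_AppP s ts s' ts' :
  canon (App s ts) = canon (App s' ts') <->
  canon s = canon s' /\ perm_eq (map canon ts) (map canon ts').
Proof.
split=> [[-> /canon_bagP //]|[/= -> /canon_bagP -> //]].
Qed.

Lemma canonK t : canon (canon t) = canon t.
Proof.
elim/rterm_ind_in: t => //= [s -> //|s ts -> IH|s -> //|s -> //].
congr App; apply/canon_bagP.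
rewrite perm_sym (perm_trans _ (perm_map canon (perm_canon_bag _))) //.
rewrite -map_comp (_ : map (canon \o canon) ts = map canon ts) //.
by apply/eq_in_map => t /IH.
Qed.

(* A finite formal sum with coefficients in nat is presented as the list of   *)
(* its summands; the constructors are extended to sums with [map].            *)
Definition rsum : Type := seq rexpr.

Definition coeff (E : rsum) (e : rexpr) : nat :=
  count_mem (canon_expr e) (map canon_expr E).

Definition supp (E : rsum) : pred rexpr := [pred e | coeff E e != 0].

Fixpoint lift (k : nat) (t : rterm) : rterm :=
  match t with
  | Var x => Var (bump k x)
  | Lam s => Lam (lift k.+1 s)
  | App s ts => App (lift k s) (map (lift k) ts)
  | Inl s => Inl (lift k s)
  | Inr s => Inr (lift k s)
  end.

(* All the ways of distributing the elements of us between u_I1 and u_I2, one *)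
(* for each pair (I1, I2) of disjoint sets of positions covering us.          *)
Fixpoint splits (us : seq rterm) : seq (seq rterm * seq rterm) :=
  match us with
  | [::] => [:: ([::], [::])]
  | u :: us' => [seq (u :: p.1, p.2) | p <- splits us']
                ++ [seq (p.1, u :: p.2) | p <- splits us']
  end.

(* The sum over (I_1, ..., I_k) is taken by choosing I_1 and then distributing*)
(* the remaining elements among I_2, ..., I_k.                                *)
Definition diff_bag (d : rterm -> seq rterm -> seq rterm) :=
  fix diff_bag (ts us : seq rterm) : seq (seq rterm) :=
    match ts with
    | [::] => if us is [::] then [:: [::]] else [::]
    | t :: ts' =>
        flatten [seq [seq t' :: r | t' <- d t p.1, r <- diff_bag ts' p.2]
                | p <- splits us]
    end.

(* The derivative of t at us with respect to the variable of index k, fused   *)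
(* with the removal of that variable (which the result no longer contains     *)
(* when t is the body of a redex, as it is then not free in us): the indices  *)
(* above k are decremented, and us lives in the context without variable k.   *)
Fixpoint diff (k : nat) (t : rterm) (us : seq rterm) : seq rterm :=
  match t with
  | Var y =>
      if y == k then (if us is [:: u] then [:: u] else [::])
      else (if us is [::] then [:: Var (unbump k y)] else [::])
  | Lam s => map Lam (diff k.+1 s (map (lift 0) us))
  | App s ts =>
      flatten [seq [seq App s' r | s' <- diff k s p.1,
                                   r <- diff_bag (diff k) ts p.2]
              | p <- splits us]
  | Inl s => map Inl (diff k s us)
  | Inr s => map Inr (diff k s us)
  end.

Inductive step : rterm -> seq rterm -> Prop :=
| step_beta s ts : step (App (Lam s) ts) (diff 0 s ts)
| step_App_Inl s ts : step (App (Inl s) ts) [:: Inl (App s ts)]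
| step_App_Inr s ts : step (App (Inr s) ts) [:: Inr (App s ts)]
| step_Lam_Inl s : step (Lam (Inl s)) [:: Inl (Lam s)]
| step_Lam_Inr s : step (Lam (Inr s)) [:: Inr (Lam s)]
| step_Lam s S : step s S -> step (Lam s) (map Lam S)
| step_App_l s S ts : step s S -> step (App s ts) [seq App s' ts | s' <- S]
| step_App_r s ts T : step_bag ts T -> step (App s ts) (map (App s) T)
| step_Inl s S : step s S -> step (Inl s) (map Inl S)
| step_Inr s S : step s S -> step (Inr s) (map Inr S)
with step_bag : seq rterm -> seq (seq rterm) -> Prop :=
| step_bag_elt ts1 t ts2 T : step t T ->
    step_bag (ts1 ++ t :: ts2) [seq ts1 ++ t' :: ts2 | t' <- T].

Inductive step_expr : rexpr -> rsum -> Prop :=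
| step_ETerm t T : step t T -> step_expr (ETerm t) (map ETerm T)
| step_EBag ts T : step_bag ts T -> step_expr (EBag ts) (map EBag T).

Inductive step_sum : rsum -> rsum -> Prop :=
| step_sum_elt F1 e F2 E' : step_expr e E' ->
    step_sum (F1 ++ e :: F2) (F1 ++ E' ++ F2).

Definition steps : rsum -> rsum -> Prop := clos_refl_trans rsum step_sum.

Definition normal (E : rsum) : Prop := forall F, ~ step_sum E F.

(* By confluence the normal form is unique up to the equality of formal sums; *)
(* it exists by Lemma NFP below.                                              *)
Definition NF (E : rsum) : rsum :=
  epsilon (inhabits [::]) (fun F => steps E F /\ normal F).

(* Termination: nodes decreases in a beta-step; the other rules preserve      *)
(* nodes and plus, and decrease the sum over all the occurrences of ⊕ of      *)
(* the number of Lam and App nodes above it.                                  *)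
Fixpoint nodes (t : rterm) : nat :=
  match t with
  | Var _ => 0
  | Lam s => (nodes s).+1
  | App s ts => (nodes s + sumn (map nodes ts)).+1
  | Inl s | Inr s => nodes s
  end.

Fixpoint plus (t : rterm) : nat :=
  match t with
  | Var _ => 0
  | Lam s => plus s
  | App s ts => plus s + sumn (map plus ts)
  | Inl s | Inr s => (plus s).+1
  end.

Fixpoint plus_height (t : rterm) : nat :=
  match t with
  | Var _ => 0
  | Lam s => plus_height s + plus s
  | App s ts => plus_height s + plus s
                + (sumn (map plus_height ts) + sumn (map plus ts))
  | Inl s | Inr s => plus_height s
  end.

Definition decr (r t : nat * nat * nat) : bool :=
  (r.1.1 < t.1.1) || [&& r.1.1 == t.1.1, r.1.2 == t.1.2 & r.2 < t.2].

Lemma decr_wf : well_founded decr.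
Proof.
have acc n : forall p h, Acc decr (n, p, h).
  elim/ltn_ind: n => n IHn p h; elim/ltn_ind: h => h IHh.
  constructor=> -[[n' p'] h'] /orP[/= lt_n|/and3P[/= /eqP-> /eqP->]].
    exact: IHn.
  exact: IHh.
by move=> [[n p] h].
Qed.

Definition meas (t : rterm) := (nodes t, plus t, plus_height t).

Definition meas_bag (ts : seq rterm) :=
  (sumn (map nodes ts), sumn (map plus ts), sumn (map plus_height ts)).

Definition meas_expr (e : rexpr) :=
  match e with ETerm t => meas t | EBag ts => meas_bag ts end.

Lemma nodes_lift k t : nodes (lift k t) = nodes t.
Proof.
elim/rterm_ind_in: t k => //= [s IH k|s ts IHs IHts k]; first by rewrite IH.
rewrite IHs -map_comp (_ : map (nodes \o lift k) ts = map nodes ts) //.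
by apply/eq_in_map => t /IHts /= ->.
Qed.

Lemma splits_nodes us p : p \in splits us ->
  sumn (map nodes p.1) + sumn (map nodes p.2) = sumn (map nodes us).
Proof.
elim: us p => [|u us IH] p /=; first by rewrite inE => /eqP->.
rewrite mem_cat => /orP[] /mapP[q /IH <- ->] /=; first by rewrite addnA.
by rewrite addnCA.
Qed.

Lemma diff_nodes k t us r :
  r \in diff k t us -> nodes r = nodes t + sumn (map nodes us).
Proof.
elim/rterm_ind_in: t k us r => [x|s IH|s ts IHs IHts|s IH|s IH] k us r /=.
- by case: eqP => _; case: us => [|u [|v us]] //=;
    rewrite inE => /eqP-> /=; rewrite ?addn0.
- case/mapP=> r' /IH + -> /= => ->; rewrite addSn -map_comp.
  by congr (_ + sumn _).+1; apply/eq_map => u; apply: nodes_lift.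
- case/flatten_mapP=> p /splits_nodes <- /allpairsP[[s' q] /= [/IHs ns nq ->]] /=.
  rewrite ns addSn addnACA; congr (_ + _).+1; move: {p ns} (p.2) q nq.
  elim: ts IHts => [|t ts IH] IHts us' q /=.
    by case: us' => //; rewrite inE => /eqP->.
  case/flatten_mapP=> p /splits_nodes <- /allpairsP[[t' q'] /= [nt nq ->]] /=.
  have IHts' u : u \in ts -> _ := fun uts => IHts u (@mem_behead _ (t :: ts) u uts).
  by rewrite (IHts t (mem_head _ _) k _ _ nt) (IH IHts' _ _ nq) addnACA.
- by case/mapP=> r' /IH + -> /= => ->.
- by case/mapP=> r' /IH + -> /= => ->.
Qed.

Scheme step_mut := Induction for step Sort Prop
with step_bag_mut := Induction for step_bag Sort Prop.
Combined Scheme step_step_bag_ind from step_mut, step_bag_mut.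

Lemma step_decr :
  (forall t T, step t T -> forall r, r \in T -> decr (meas r) (meas t)) /\
  (forall ts T, step_bag ts T ->
     forall rs, rs \in T -> decr (meas_bag rs) (meas_bag ts)).
Proof.
apply: step_step_bag_ind; rewrite /decr /=.
- by move=> s ts r /diff_nodes->; apply/orP; left; rewrite addSn ltnS leqW.
- by move=> s ts r; rewrite inE => /eqP-> /=; lia.
- by move=> s ts r; rewrite inE => /eqP-> /=; lia.
- by move=> s r; rewrite inE => /eqP-> /=; lia.
- by move=> s r; rewrite inE => /eqP-> /=; lia.
- by move=> s S _ IH r /mapP[s' /IH/= + ->] /=; lia.
- by move=> s S ts _ IH r /mapP[s' /IH/= + ->] /=; lia.
- by move=> s ts T _ IH r /mapP[ts' /IH/= + ->] /=; lia.
- by move=> s S _ IH r /mapP[s' /IH/= + ->] /=; lia.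
- by move=> s S _ IH r /mapP[s' /IH/= + ->] /=; lia.
- move=> ts1 t ts2 T _ IH r /mapP[t' /IH/= + ->].
  by rewrite !map_cat /= !sumn_cat /=; lia.
Qed.

Lemma step_expr_decr e E : step_expr e E ->
  forall e', e' \in E -> decr (meas_expr e') (meas_expr e).
Proof.
case=> [t T /(proj1 step_decr) IH|ts T /(proj2 step_decr) IH] e'.
  by case/mapP=> r /IH + ->.
by case/mapP=> r /IH + ->.
Qed.

Lemma step_sum_cat F E E' F' :
  step_sum E E' -> step_sum (F ++ E ++ F') (F ++ E' ++ F').
Proof.
case=> F1 e F2 G eG; have := step_sum_elt (F ++ F1) (F2 ++ F') eG.
by rewrite -!catA.
Qed.

Lemma steps_cat E1 E2 F1 F2 :
  steps E1 F1 -> steps E2 F2 -> steps (E1 ++ E2) (F1 ++ F2).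
Proof.
move=> s1 s2; apply: (@rt_trans _ _ _ (F1 ++ E2)).
  elim: s1 => [E F EF|E|E F G _ IH1 _ IH2]; first 2 last.
  - exact: rt_trans IH1 IH2.
  - by apply: rt_step; apply: (step_sum_cat [::]).
  - exact: rt_refl.
elim: s2 => [E F EF|E|E F G _ IH1 _ IH2]; first 2 last.
- exact: rt_trans IH1 IH2.
- by apply: rt_step; have := step_sum_cat F1 [::] EF; rewrite !cats0.
- exact: rt_refl.
Qed.

Lemma normalP E :
  normal E <-> forall e, e \in E -> forall F, ~ step_expr e F.
Proof.
split=> [nE e eE F eF|nE F EF]; last first.
  case: EF nE => F1 e F2 G eG /(_ e) nE; apply: (nE _ G eG).
  by rewrite mem_cat mem_head orbT.
case/splitPr: eE nE => F1 F2 nE; exact: nE (step_sum_elt F1 F2 eF).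
Qed.

Lemma normalizing E : exists F, steps E F /\ normal F.
Proof.
suff nf1 e : exists F, steps [:: e] F /\ normal F.
  elim: E => [|e E [F [EF nF]]].
    by exists [::]; split; [apply: rt_refl | apply/normalP].
  have [G [eG nG]] := nf1 e; exists (G ++ F); split.
    exact: (steps_cat eG EF).
  by apply/normalP=> f; rewrite mem_cat => /orP[]; move: f; apply/normalP.
move: {2}(meas_expr e) (erefl (meas_expr e)) => {E} m em.
elim: m / (decr_wf m) e em => m _ IH e em.
have [[E eE]|ne] := excluded_middle_informative (exists E, step_expr e E); last first.
  exists [:: e]; split; first exact: rt_refl.
  by apply/normalP=> f; rewrite inE => /eqP-> F eF; apply: ne; exists F.
have: forall f, f \in E -> exists F, steps [:: f] F /\ normal F.
  by move=> f /(step_expr_decr eE) d; apply: (IH (meas_expr f)) => //; rewrite -em.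
move=> nfE; suff [F [EF nF]]: exists F, steps E F /\ normal F.
  exists F; split=> //; apply: rt_trans EF; apply: rt_step.
  by have := step_sum_elt [::] [::] eE; rewrite /= cats0.
elim: E {eE} nfE => [|f E IHE] nfE.
  by exists [::]; split; [apply: rt_refl | apply/normalP].
have [F [fF nF]] := nfE f (mem_head _ _).
have [|G [EG nG]] := IHE; first by move=> g gE; apply: nfE; rewrite inE gE orbT.
exists (F ++ G); split; first exact: (steps_cat fF EG).
by apply/normalP=> g; rewrite mem_cat => /orP[]; move: g; apply/normalP.
Qed.

Lemma NFP E : steps E (NF E) /\ normal (NF E).
Proof. exact: epsilon_spec (normalizing E). Qed.

Inductive coh : rterm -> rterm -> Prop :=
| coh_Var x : coh (Var x) (Var x)
| coh_Lam s s' : coh s s' -> coh (Lam s) (Lam s')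
| coh_App s s' ts ts' : coh s s' -> coh_bag ts ts' ->
    coh (App s ts) (App s' ts')
| coh_Inl s s' : coh s s' -> coh (Inl s) (Inl s')
| coh_Inr s s' : coh s s' -> coh (Inr s) (Inr s')
| coh_InlInr s s' : coh (Inl s) (Inr s')
| coh_InrInl s s' : coh (Inr s) (Inl s')
with coh_bag : seq rterm -> seq rterm -> Prop :=
| coh_bag_elts ts ts' :
    (forall t t', t \in ts ++ ts' -> t' \in ts ++ ts' -> coh t t') ->
    coh_bag ts ts'.

Inductive coh_expr : rexpr -> rexpr -> Prop :=
| coh_ETerm t t' : coh t t' -> coh_expr (ETerm t) (ETerm t')
| coh_EBag ts ts' : coh_bag ts ts' -> coh_expr (EBag ts) (EBag ts').

(* The element t of a monomial is given as the pair (canon t, m(t)) in order  *)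
(* to make the recursion structural; see mult_bagE.                           *)
Definition mult_pairs (ps : seq (rterm * nat)) : nat :=
  \prod_(p <- undup ps) ((count_mem p ps)`! * p.2 ^ count_mem p ps).

Fixpoint mult (t : rterm) : nat :=
  match t with
  | Var _ => 1
  | Lam s | Inl s | Inr s => mult s
  | App s ts => mult s * mult_pairs [seq (canon t, mult t) | t <- ts]
  end.

Definition mult_bag (ts : seq rterm) : nat :=
  mult_pairs [seq (canon t, mult t) | t <- ts].

Definition mult_expr (e : rexpr) : nat :=
  match e with ETerm t => mult t | EBag ts => mult_bag ts end.

Lemma perm_mult_pairs ps qs :
  perm_eq ps qs -> mult_pairs ps = mult_pairs qs.
Proof.
move=> eq_pq; rewrite /mult_pairs (perm_big (undup qs)) /=.
  by apply: eq_bigr => p _; rewrite (permP eq_pq).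
apply: uniq_perm; rewrite ?undup_uniq // => p.
by rewrite !mem_undup (perm_mem eq_pq).
Qed.

Lemma mult_canon t : mult (canon t) = mult t.
Proof.
elim/rterm_ind_in: t => //= s ts -> IH; congr (_ * _).
rewrite -(perm_mult_pairs (perm_map _ (perm_canon_bag _))) -map_comp.
by congr mult_pairs; apply/eq_in_map => t /IH /= ->; rewrite canonK.
Qed.

Lemma mult_bagE ts (cs := map canon ts) :
  mult_bag ts =
  \prod_(t <- undup cs) ((count_mem t cs)`! * mult t ^ count_mem t cs).
Proof.
pose f (c : rterm) := (c, mult c).
have f_inj : injective f by move=> c d [].
rewrite /mult_bag /mult_pairs.
have -> : [seq (canon t, mult t) | t <- ts] = map f cs.
  by rewrite -map_comp; apply/eq_map => t /=; rewrite /f mult_canon.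
rewrite undup_map_inj // big_map; apply: eq_bigr => c _.
suff -> : count_mem (f c) (map f cs) = count_mem c cs by [].
by rewrite count_map; apply: eq_count => d; rewrite /= (inj_eq f_inj).
Qed.

(* Main.v *)
Require Import Defs.
From mathcomp Require Import all_boot all_order all_algebra.
From mathcomp Require Import zify ring.
From Stdlib Require Import ClassicalEpsilon FunctionalExtensionality.

(* Shadows [fintype.lift] by the lifting of terms.                            *)
Import Defs.

Set Implicit Arguments.
Unset Strict Implicit.
Unset Printing Implicit Defensive.

(* For list-presented terms each rule fires linearly, so that a pair of       *)
(* divergent steps closes in at most two steps and, for every c, there is a   *)
(* function g on terms with g t = sum of g over T for each step t -> T, and   *)
(* g t = [t is c up to permutations] for t normal: g t is the coefficient of  *)
(* c in NF(t), whatever the strategy.  A single step breaks coherence, since  *)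
(* it reduces only one of several coherent copies.  The parallel reduction    *)
(* head_red, which treats coherent terms in the same way, preserves it;       *)
(* moreover a reduct determines, among coherent terms, the term it comes      *)
(* from, and it occurs m(t)/m(r) times as a reduct r of t.  These facts hold  *)
(* first for the derivatives, by counting the splittings of the argument, and *)
(* they compose along head_red: all the reducts of t that reach c are equal   *)
(* up to permutations, whence the quotient m(t)/m(c) by telescoping.          *)

(** Fix [c]. The coefficient of [c] in NF(t) is an additive function [g] of t: every step preserves
    it, and on a normal term it is 1 or 0 according to whether the term equals [c]. Such a [g] is
    obtained in [exists_step_inv]. Its independence of the strategy is local confluence
    ([step_unique]), which rests on the linearity of the derivative: a step inside the body or the
    argument of a redex commutes with firing the redex ([step_diff], [step_diff_arg]), and for a
    redex inside the body of another one this is the substitution lemma [sum_diff_diff].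

    The value of the coefficient comes from counting symmetries: m(t) is the number of permutations
    of the nested monomials of t that leave t unchanged. The derivative of t at u sums over all
    distributions of the elements of u. When t and u are coherent with themselves, a summand r
    determines t, and the share of u that each of its parts has received ([diff_coh]), so that the
    distributions yielding r differ only by exchanging equal elements. There are m(t) m(u) / m(r) of
    them ([diff_multE]), the elementary case being the binomial count [count_splitsE].

    The same two properties hold for the parallel reduction [head_red]: coherent terms have coherent
    reducts, a reduct determines its origin ([head_red_coh]), and r has coefficient m(t) / m(r)
    among the reducts of t ([head_red_mult]). By induction on the termination measure, coherent
    terms whose normal forms both contain [c] are equal ([coh_step_inv_inj]). Hence a single reduct
    r of t, up to permutations, contributes to [c], and the product of m(t) / m(r) and m(r) / m(c)
    telescopes to m(t) / m(c) ([step_inv_mult]). *)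

Notation bag := (seq rterm).

(** * Sums over the splittings of a monomial *)

(** Identities between derivatives are stated as identities between sums of an arbitrary weight over
    them, so that the order in which the summands are listed never matters. *)
Definition sum_splits (us : bag) (F : bag -> bag -> nat) : nat :=
  \sum_(p <- splits us) F p.1 p.2.

Lemma eq_sum_splits us F G :
  (forall a b, F a b = G a b) -> sum_splits us F = sum_splits us G.
Proof. by move=> FG; apply: eq_bigr. Qed.

Lemma sum_splits_nil F : sum_splits [::] F = F [::] [::].
Proof. exact: big_seq1. Qed.

Lemma sum_splits_cons u us F :
  sum_splits (u :: us) F =
  sum_splits us (fun a b => F (u :: a) b) + sum_splits us (fun a b => F a (u :: b)).
Proof. by rewrite /sum_splits /= big_cat !big_map. Qed.

Lemma sum_splitsD us F G :
  sum_splits us (fun a b => F a b + G a b) = sum_splits us F + sum_splits us G.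
Proof. exact: big_split. Qed.

Lemma sum_splits0 us : sum_splits us (fun _ _ => 0) = 0.
Proof. exact: big1_eq. Qed.

Lemma sum_splits_sum us (I : Type) (A : seq I) F :
  sum_splits us (fun a b => \sum_(x <- A) F a b x) =
  \sum_(x <- A) sum_splits us (fun a b => F a b x).
Proof. exact: exchange_big. Qed.

Lemma sum_splits_exchange us vs F :
  sum_splits us (fun a b => sum_splits vs (fun c d => F a b c d)) =
  sum_splits vs (fun c d => sum_splits us (fun a b => F a b c d)).
Proof. exact: exchange_big. Qed.

Lemma sum_splits_cat us vs F :
  sum_splits (us ++ vs) F =
  sum_splits us (fun a b => sum_splits vs (fun c d => F (a ++ c) (b ++ d))).
Proof.
elim: us F => [|u us IH] F; first by rewrite sum_splits_nil.
by rewrite cat_cons !sum_splits_cons !IH.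
Qed.

Lemma sum_splits_mid us u vs F :
  sum_splits (us ++ u :: vs) F =
  sum_splits us (fun a b => sum_splits vs (fun c d =>
    F (a ++ u :: c) (b ++ d) + F (a ++ c) (b ++ u :: d))).
Proof.
rewrite sum_splits_cat; apply: eq_sum_splits => a b.
by rewrite sum_splits_cons sum_splitsD.
Qed.

Lemma sum_splits_left us F :
  (forall a v b, F a (v :: b) = 0) -> sum_splits us F = F us [::].
Proof.
elim: us F => [|u us IH] F F0; first exact: sum_splits_nil.
rewrite sum_splits_cons IH //.
by under eq_sum_splits => a b do rewrite F0; rewrite sum_splits0 addn0.
Qed.

Lemma sum_splits_right us F :
  (forall v a b, F (v :: a) b = 0) -> sum_splits us F = F [::] us.
Proof.
elim: us F => [|u us IH] F F0; first exact: sum_splits_nil.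
rewrite sum_splits_cons [X in _ + X]IH //.
by under eq_sum_splits => a b do rewrite F0; rewrite sum_splits0.
Qed.

(** Both sides range over the distributions of [us] among three monomials. *)
Lemma sum_splitsA us F :
  sum_splits us (fun a b => sum_splits a (fun c d => F c d b)) =
  sum_splits us (fun a b => sum_splits b (fun c d => F a c d)).
Proof.
elim: us F => [|u us IH] F; first by rewrite !sum_splits_nil.
rewrite !sum_splits_cons.
under eq_sum_splits => a b do rewrite sum_splits_cons.
under [X in _ = _ + X]eq_sum_splits => a b do rewrite sum_splits_cons.
rewrite !sum_splitsD (IH (fun a b c => F (u :: a) b c)).
by rewrite (IH (fun a b c => F a (u :: b) c)) (IH (fun a b c => F a b (u :: c))) addnA.
Qed.

Lemma sum_splitsC us F :
  sum_splits us F = sum_splits us (fun a b => F b a).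
Proof.
elim: us F => [|u us IH] F; first by rewrite !sum_splits_nil.
rewrite !sum_splits_cons addnC IH; congr (_ + _).
by rewrite IH.
Qed.

Lemma sum_splitsCA us F :
  sum_splits us (fun a b => sum_splits b (fun c d => F a c d)) =
  sum_splits us (fun a b => sum_splits b (fun c d => F c a d)).
Proof.
rewrite -sum_splitsA -[RHS]sum_splitsA; apply: eq_sum_splits => a b.
exact: sum_splitsC.
Qed.

(* Distributing us over a 2 x 2 array, row by row or column by column.        *)
Lemma sum_splits_interchange us F :
  sum_splits us (fun a b => sum_splits a (fun a1 a2 =>
    sum_splits b (fun b1 b2 => F a1 a2 b1 b2))) =
  sum_splits us (fun a b => sum_splits a (fun a1 a2 =>
    sum_splits b (fun b1 b2 => F a1 b1 a2 b2))).
Proof.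
elim: us F => [|u us IH] F; first by rewrite !sum_splits_nil.
rewrite !sum_splits_cons.
under eq_sum_splits => a b do rewrite sum_splits_cons.
under [X in _ + X = _]eq_sum_splits => a b.
  under eq_sum_splits => c d do rewrite sum_splits_cons.
  rewrite sum_splitsD; over.
under [X in _ = X + _]eq_sum_splits => a b do rewrite sum_splits_cons.
under [X in _ = _ + X]eq_sum_splits => a b.
  under eq_sum_splits => c d do rewrite sum_splits_cons.
  rewrite sum_splitsD; over.
rewrite !sum_splitsD (IH (fun a b c d => F (u :: a) b c d)).
rewrite (IH (fun a b c d => F a (u :: b) c d)) (IH (fun a b c d => F a b (u :: c) d)).
by rewrite (IH (fun a b c d => F a b c (u :: d))) addnACA.
Qed.

Lemma sum_splits_map (f : rterm -> rterm) us F :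
  sum_splits (map f us) F = sum_splits us (fun a b => F (map f a) (map f b)).
Proof.
elim: us F => [|u us IH] F; first by rewrite !sum_splits_nil.
by rewrite !sum_splits_cons !IH.
Qed.

Lemma perm_splits us p : p \in splits us -> perm_eq us (p.1 ++ p.2).
Proof.
elim: us p => [|u us IH] p /=; first by rewrite inE => /eqP->.
rewrite mem_cat => /orP[] /mapP[q /IH qP ->] /=; first by rewrite perm_cons.
by rewrite perm_sym -cat1s perm_catCA /= perm_cons perm_sym.
Qed.

Section DiffBag.

Variable d : rterm -> bag -> seq rterm.

Lemma sum_diff_bag_nil us (G : bag -> nat) :
  \sum_(r <- diff_bag d [::] us) G r = if us is [::] then G [::] else 0.
Proof. by case: us => [|u us] /=; rewrite ?big_seq1 ?big_nil. Qed.

Lemma sum_diff_bag_cons t ts us (G : bag -> nat) :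
  \sum_(r <- diff_bag d (t :: ts) us) G r =
  sum_splits us (fun a b =>
    \sum_(t' <- d t a) \sum_(r <- diff_bag d ts b) G (t' :: r)).
Proof.
rewrite /= big_flatten big_map; apply: eq_bigr => p _.
by rewrite big_allpairs_dep.
Qed.

Lemma sum_diff_bag_seq1 t us (G : bag -> nat) :
  \sum_(r <- diff_bag d [:: t] us) G r = \sum_(t' <- d t us) G [:: t'].
Proof.
rewrite sum_diff_bag_cons sum_splits_left => [|a v b]; last first.
  by apply: big1 => t' _; rewrite sum_diff_bag_nil.
by apply: eq_bigr => t' _; rewrite sum_diff_bag_nil.
Qed.

(** The application case of [diff] for an abstract [d], which is later instantiated by the
    derivative and by the parallel reduction. *)
Definition diff_app (s : rterm) (ts us : bag) : seq rterm :=
  flatten [seq [seq App s' r | s' <- d s p.1, r <- diff_bag d ts p.2]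
          | p <- splits us].

Lemma sum_diff_app s ts us (g : rterm -> nat) :
  \sum_(r <- diff_app s ts us) g r =
  sum_splits us (fun a b =>
    \sum_(s' <- d s a) \sum_(r <- diff_bag d ts b) g (App s' r)).
Proof.
rewrite /diff_app big_flatten big_map; apply: eq_bigr => p _.
by rewrite big_allpairs_dep.
Qed.

(** Each element of [r] stems from one element of [ts] and its share of [us], so that splitting [r]
    amounts to splitting [ts] and [us] independently. *)
Lemma sum_diff_bag_splits ts us F :
  \sum_(r <- diff_bag d ts us) sum_splits r F =
  sum_splits ts (fun ts1 ts2 => sum_splits us (fun us1 us2 =>
    \sum_(x <- diff_bag d ts1 us1) \sum_(y <- diff_bag d ts2 us2) F x y)).
Proof.
elim: ts us F => [|t ts IH] us F.
  rewrite sum_diff_bag_nil !sum_splits_nil.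
  rewrite sum_splits_right => [|v a b]; last by rewrite sum_diff_bag_nil.
  by rewrite !sum_diff_bag_nil.
rewrite sum_diff_bag_cons sum_splits_cons.
under eq_sum_splits => a b.
  under eq_bigr => t' _.
    under eq_bigr => r _ do rewrite sum_splits_cons.
    rewrite big_split /= !IH -sum_splitsD.
    under eq_sum_splits => ts1 ts2 do rewrite -sum_splitsD; over.
  rewrite -sum_splits_sum; over.
rewrite sum_splits_exchange -sum_splitsD; apply: eq_sum_splits => ts1 ts2.
under eq_sum_splits => a b.
  rewrite -sum_splits_sum.
  under eq_sum_splits => c e do rewrite big_split.
  rewrite sum_splitsD; over.
rewrite sum_splitsD; congr (_ + _); last first.
  rewrite sum_splitsCA; apply: eq_sum_splits => a b.
  under [RHS]eq_bigr => x _ do rewrite sum_diff_bag_cons.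
  rewrite -sum_splits_sum; apply: eq_sum_splits => c e; exact: exchange_big.
rewrite -(sum_splitsA _ (fun a c e => \sum_(i <- d t a) \sum_(x <- diff_bag d ts1 c)
     \sum_(y <- diff_bag d ts2 e) F (i :: x) y)).
by apply: eq_sum_splits => a b; rewrite sum_diff_bag_cons.
Qed.

End DiffBag.

(** * Lifting and substitution *)

Lemma lift_lift i k t : i <= k -> lift k.+1 (lift i t) = lift i (lift k t).
Proof.
elim/rterm_ind_in: t i k => /= [x|s IH|s ts IHs IHts|s IH|s IH] i k ik.
- by congr Var; rewrite /bump; lia.
- by rewrite IH.
- rewrite IHs // -!map_comp; congr App; apply/eq_in_map => t /IHts; exact.
- by rewrite IH.
- by rewrite IH.
Qed.

Lemma map_lift_lift i k ts : i <= k ->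
  map (lift k.+1) (map (lift i) ts) = map (lift i) (map (lift k) ts).
Proof. by move=> ik; rewrite -!map_comp; apply: eq_map => t /=; apply: lift_lift. Qed.

Lemma splits_map (f : rterm -> rterm) us :
  splits (map f us) = [seq (map f p.1, map f p.2) | p <- splits us].
Proof. by elim: us => //= u us ->; rewrite map_cat -!map_comp. Qed.

Lemma diff_bag_map (f h : rterm -> rterm) (d d' : rterm -> bag -> seq rterm) ts us :
  (forall t, t \in ts -> forall us, d' (h t) (map f us) = map f (d t us)) ->
  diff_bag d' (map h ts) (map f us) = map (map f) (diff_bag d ts us).
Proof.
elim: ts us => [|t ts IH] us dd'; first by case: us.
rewrite /= splits_map map_flatten -!map_comp; congr flatten; apply: eq_map => p /=.
rewrite dd' ?mem_head // IH => [|u uts]; last by apply: dd'; rewrite inE uts orbT.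
by rewrite map_allpairs allpairs_mapl allpairs_mapr.
Qed.

Lemma diff_App k s ts us : diff k (App s ts) us = diff_app (diff k) s ts us.
Proof. by []. Qed.

Lemma diff_Inl k s us : diff k (Inl s) us = map Inl (diff k s us).
Proof. by []. Qed.

Lemma diff_Inr k s us : diff k (Inr s) us = map Inr (diff k s us).
Proof. by []. Qed.

Lemma diff_app_map (f h : rterm -> rterm) (d d' : rterm -> bag -> seq rterm) s ts us :
  (forall s ts, f (App s ts) = App (f s) (map f ts)) ->
  (forall us, d' (h s) (map f us) = map f (d s us)) ->
  (forall t, t \in ts -> forall us, d' (h t) (map f us) = map f (d t us)) ->
  diff_app d' (h s) (map h ts) (map f us) = map f (diff_app d s ts us).
Proof.
move=> fA ds dts; rewrite /diff_app splits_map map_flatten -!map_comp; congr flatten.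
apply: eq_map => p /=.
rewrite ds (diff_bag_map _ dts) map_allpairs allpairs_mapl allpairs_mapr.
by apply: eq_allpairs => // a b; rewrite fA.
Qed.

(** The lift of [t] is at [j.+1] because [diff] removes the variable [i], which lies below, and
    decrements the indices above it. *)
Lemma lift_diff_above j i t us : i <= j ->
  diff i (lift j.+1 t) (map (lift j) us) = map (lift j) (diff i t us).
Proof.
elim/rterm_ind_in: t i j us => [x|s IH|s ts IHs IHts|s IH|s IH] i j us ij.
- rewrite /= /bump; case: (x =P i) => [->|xi].
    by rewrite ltnNge ij /= add0n eqxx; case: us => [|u [|]].
  rewrite ifN; last by apply/eqP; move: xi; case: (ltnP j x) => /= ?; lia.
  case: us => //=; congr [:: Var _]; rewrite /unbump /bump; lia.
- by rewrite /= -map_lift_lift // IH // -!map_comp.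
- rewrite !diff_App; apply: diff_app_map => // [{}us|t /IHts IH {}us]; [exact: IHs|exact: IH].
- by rewrite /= IH // -!map_comp.
- by rewrite /= IH // -!map_comp.
Qed.

Lemma lift_diff_below j i t us : j <= i ->
  diff i.+1 (lift j t) (map (lift j) us) = map (lift j) (diff i t us).
Proof.
elim/rterm_ind_in: t i j us => [x|s IH|s ts IHs IHts|s IH|s IH] i j us ij.
- rewrite /= /bump; case: (x =P i) => [->|xi].
    by rewrite ij /= add1n eqxx; case: us => [|u [|]].
  rewrite ifN; last by apply/eqP; move: xi; case: (leqP j x) => /= ?; lia.
  case: us => //=; congr [:: Var _]; rewrite /unbump /bump; lia.
- by rewrite /= -map_lift_lift // IH // -!map_comp.
- rewrite !diff_App; apply: diff_app_map => // [{}us|t /IHts IH {}us]; [exact: IHs|exact: IH].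
- by rewrite /= IH // -!map_comp.
- by rewrite /= IH // -!map_comp.
Qed.

(** The variable [k] does not occur in [lift k t], so no element of [us] can be placed. *)
Lemma sum_diff_lift k t us (g : rterm -> nat) :
  \sum_(r <- diff k (lift k t) us) g r = if us is [::] then g t else 0.
Proof.
elim/rterm_ind_in: t k us g => [x|s IH|s ts IHs IHts|s IH|s IH] k us g.
- rewrite /= ifN; last by rewrite eq_sym neq_bump.
  by case: us => [|u us]; rewrite ?big_nil ?big_seq1 ?bumpK.
- by rewrite /= big_map IH; case: us.
- rewrite diff_App sum_diff_app.
  have db vs (G : bag -> nat) : \sum_(r <- diff_bag (diff k) (map (lift k) ts) vs) G r =
      if vs is [::] then G ts else 0.
    elim: ts IHts vs G => [|t ts IH] IHts vs G; first exact: sum_diff_bag_nil.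
    rewrite map_cons sum_diff_bag_cons sum_splits_right => [|v a b]; last first.
      by rewrite IHts ?mem_head.
    rewrite IHts ?mem_head // IH // => u uts; apply: IHts; by rewrite inE uts orbT.
  rewrite sum_splits_right => [|v a b]; last by rewrite IHs.
  by rewrite IHs db.
- by rewrite /= big_map IH; case: us.
- by rewrite /= big_map IH; case: us.
Qed.


Lemma sum_diff_bag_neq0 d t ts us (G : bag -> nat) :
  (forall t r, G (t :: r) = 0) -> \sum_(r <- diff_bag d (t :: ts) us) G r = 0.
Proof.
move=> G0; rewrite sum_diff_bag_cons; apply: big1 => p _; apply: big1 => t' _.
exact: big1.
Qed.

Section Substitution.

Variables (T1 T2 : Type) (k : nat).
Variables (X1 X1' : bag -> seq T1) (Y1 Z1 : T1 -> bag -> seq T1).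
Variables (X2 X2' : bag -> seq T2) (Y2 Z2 : T2 -> bag -> seq T2).
Hypothesis subst1 : forall vs us (g : T1 -> nat),
  \sum_(x <- X1 vs) \sum_(x' <- Y1 x us) g x' =
  sum_splits us (fun a b => \sum_(x <- X1' a) \sum_(v <- diff_bag (diff k) vs b)
    \sum_(x' <- Z1 x v) g x').
Hypothesis subst2 : forall vs us (g : T2 -> nat),
  \sum_(x <- X2 vs) \sum_(x' <- Y2 x us) g x' =
  sum_splits us (fun a b => \sum_(x <- X2' a) \sum_(v <- diff_bag (diff k) vs b)
    \sum_(x' <- Z2 x v) g x').

(** The inductive step of the substitution lemma, common to applications and to nonempty monomials:
    a pair of components, each of which satisfies it. On both sides [us] is distributed over four
    places; the left side groups them by component, the right side separates the components from
    [vs]. *)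
Lemma sum_subst_pair vs us (G : T1 -> T2 -> nat) :
  sum_splits vs (fun c e => \sum_(x <- X1 c) \sum_(y <- X2 e)
    sum_splits us (fun a b => \sum_(x' <- Y1 x a) \sum_(y' <- Y2 y b) G x' y')) =
  sum_splits us (fun a b => sum_splits a (fun a1 a2 =>
    \sum_(x <- X1' a1) \sum_(y <- X2' a2) \sum_(v <- diff_bag (diff k) vs b)
      sum_splits v (fun c e => \sum_(x' <- Z1 x c) \sum_(y' <- Z2 y e) G x' y'))).
Proof.
(* [a1] and [b1] are the shares of the two components, [a2] and [b2] those of the parts of [vs]
   substituted in them. *)
pose K a1 b1 a2 b2 := sum_splits vs (fun c e => \sum_(x <- X1' a1)
  \sum_(y <- X2' b1) \sum_(v1 <- diff_bag (diff k) c a2)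
  \sum_(v2 <- diff_bag (diff k) e b2) \sum_(x' <- Z1 x v1) \sum_(y' <- Z2 y v2) G x' y').
transitivity (sum_splits us (fun a b => sum_splits a (fun a1 a2 =>
    sum_splits b (fun b1 b2 => K a1 b1 a2 b2)))); last first.
  rewrite sum_splits_interchange; apply: eq_sum_splits => a b.
  apply: eq_sum_splits => a1 a2; rewrite /K sum_splits_exchange.
  under [RHS]eq_bigr => x _.
    under eq_bigr => y _ do rewrite sum_diff_bag_splits.
    rewrite -sum_splits_sum; over.
  rewrite -sum_splits_sum; apply: eq_sum_splits => c e.
  rewrite sum_splits_sum; apply: eq_bigr => x _.
  rewrite sum_splits_sum; apply: eq_bigr => y _ //.
under eq_sum_splits => c e.
  under eq_bigr => x _ do rewrite -sum_splits_sum.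
  rewrite -sum_splits_sum.
  under eq_sum_splits => a b.
    under eq_bigr => x _.
      rewrite exchange_big /=.
      under eq_bigr => x' _ do rewrite subst2.
      over.
    rewrite subst1; over.
  over.
rewrite sum_splits_exchange; apply: eq_sum_splits => a b.
rewrite sum_splits_exchange; apply: eq_sum_splits => a1 a2.
rewrite /K sum_splits_exchange; apply: eq_sum_splits => c e.
under eq_bigr => x _.
  under eq_bigr => v1 _ do rewrite -sum_splits_sum.
  rewrite -sum_splits_sum; over.
rewrite -sum_splits_sum; apply: eq_sum_splits => b1 b2; apply: eq_bigr => x _.
rewrite exchange_big /=.
under eq_bigr => v1 _ do rewrite exchange_big /=.
apply: eq_bigr => v1 _; apply: eq_bigr => y _; exact: exchange_big.
Qed.

End Substitution.

Lemma sum_diff_bag_comm (d1 d2 d3 d4 : rterm -> bag -> seq rterm) k (f : rterm -> rterm)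
    ts vs us (G : bag -> nat) :
  (forall t, t \in ts -> forall vs us (g : rterm -> nat),
    \sum_(r <- d1 t vs) \sum_(r' <- d2 r us) g r' =
    sum_splits us (fun a b => \sum_(t' <- d3 t (map f a))
      \sum_(v <- diff_bag (diff k) vs b) \sum_(r <- d4 t' v) g r)) ->
  \sum_(r <- diff_bag d1 ts vs) \sum_(r' <- diff_bag d2 r us) G r' =
  sum_splits us (fun a b => \sum_(ts' <- diff_bag d3 ts (map f a))
    \sum_(v <- diff_bag (diff k) vs b) \sum_(r <- diff_bag d4 ts' v) G r).
Proof.
elim: ts vs us G => [|t ts IH] vs us G dts.
  rewrite sum_diff_bag_nil sum_splits_right => [|v a b]; last by rewrite sum_diff_bag_nil.
  rewrite [map f [::]]/= sum_diff_bag_nil; case: vs => [|v vs].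
    by rewrite !sum_diff_bag_nil; case: us => //; rewrite sum_diff_bag_nil.
  by rewrite sum_diff_bag_nil sum_diff_bag_neq0 // => w r; rewrite sum_diff_bag_nil.
have IHts vs' us' G' := IH vs' us' G' (fun u uts => dts u (@mem_behead _ (t :: ts) u uts)).
rewrite sum_diff_bag_cons.
under eq_sum_splits => a b.
  under eq_bigr => t' _ do under eq_bigr => r _ do rewrite sum_diff_bag_cons.
  over.
rewrite (@sum_subst_pair _ _ k (d1 t) (fun a => d3 t (map f a)) d2 d4
  (diff_bag d1 ts) (fun a => diff_bag d3 ts (map f a)) (diff_bag d2) (diff_bag d4)
  (dts t (mem_head t ts)) IHts vs us (fun t' r => G (t' :: r))).
apply: eq_sum_splits => a b; rewrite sum_diff_bag_cons sum_splits_map.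
apply: eq_sum_splits => a1 a2; apply: eq_bigr => x _; apply: eq_bigr => y _.
by apply: eq_bigr => v _; rewrite sum_diff_bag_cons.
Qed.

(* [us] lives in the context from which the variable i has been removed,      *)
(* whence the lift.                                                           *)
Lemma sum_diff_diff i k t vs us (g : rterm -> nat) : i <= k ->
  \sum_(r <- diff i t vs) \sum_(r' <- diff k r us) g r' =
  sum_splits us (fun a b =>
    \sum_(t' <- diff k.+1 t (map (lift i) a)) \sum_(v <- diff_bag (diff k) vs b)
      \sum_(r <- diff i t' v) g r).
Proof.
elim/rterm_ind_in: t i k vs us g => [x|s IH|s ts IHs IHts|s IH|s IH] i k vs us g ik.
- have [->|xi] := eqVneq x i.
    rewrite /= eqxx (_ : (i == k.+1) = false); last by lia.
    rewrite sum_splits_right; last by move=> v a b; rewrite big_nil.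
    rewrite big_seq1 (_ : unbump k.+1 i = i) ?eqxx; last by rewrite /unbump; lia.
    case: vs => [|v [|w vs]].
    + rewrite big_nil sum_diff_bag_nil; case: us => //=.
      by rewrite eqxx big_nil.
    + by rewrite big_seq1 sum_diff_bag_seq1; apply: eq_bigr => t' _; rewrite /= eqxx big_seq1.
    + rewrite big_nil sum_diff_bag_cons /sum_splits big1 // => a _; rewrite big1 // => t' _.
      by rewrite sum_diff_bag_neq0 // => u' r /=; rewrite eqxx big_nil.
  have [xk|xk] := eqVneq x k.+1.
    rewrite /= (negbTE xi) xk eqxx; case: vs => [|v vs]; last first.
      rewrite big_nil /sum_splits big1 // => p _; rewrite big1_seq // => t'.
      case: (p.1) => [|u [|]] //=; rewrite inE => /eqP->.
      by rewrite sum_diff_bag_neq0 // => u' r; rewrite sum_diff_lift.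
    rewrite big_seq1 /= (_ : unbump i k.+1 = k) ?eqxx; last by rewrite /unbump; lia.
    rewrite sum_splits_left; last first.
      by move=> a v b; rewrite big1 // => t' _; rewrite big_nil.
    case: us => [|u [|u' us]] /=; rewrite ?big_nil ?big_seq1 ?sum_diff_lift //.
  rewrite /= (negbTE xi) (negbTE xk) sum_splits_right; last first.
    by move=> v a b; rewrite big_nil.
  case: vs => [|v vs].
    rewrite !big_seq1 /= (_ : (unbump i x == k) = false); last by rewrite /unbump; lia.
    rewrite (_ : (unbump k.+1 x == i) = false); last by rewrite /unbump; lia.
    case: us => [|u us] /=; rewrite ?big_nil // !big_seq1.
    congr (g (Var _)); rewrite /unbump; lia.
  rewrite big_nil !big_seq1 sum_diff_bag_neq0 // => t' r /=.
  by rewrite (_ : (unbump k.+1 x == i) = false) ?big_nil //; rewrite /unbump; lia.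
- rewrite /= !big_map; under eq_bigr => r _ do rewrite /= big_map.
  rewrite (IH i.+1 k.+1) //= sum_splits_map; apply: eq_sum_splits => a b.
  rewrite map_lift_lift // big_map; apply: eq_bigr => t' _.
  rewrite (@diff_bag_map (lift 0) (lift 0) (diff k) (diff k.+1)); last first.
    by move=> t _ us'; rewrite lift_diff_below.
  by rewrite big_map; apply: eq_bigr => v _; rewrite /= big_map.
- rewrite !diff_App sum_diff_app.
  under eq_sum_splits => a b.
    under eq_bigr => t' _ do under eq_bigr => r _ do rewrite sum_diff_app.
    over.
  have db vs' us' G := @sum_diff_bag_comm _ _ _ _ k (lift i) ts vs' us' G
    (fun t tts vs us g => IHts t tts i k vs us g ik).
  rewrite (@sum_subst_pair _ _ k (diff i s) (fun a => diff k.+1 s (map (lift i) a))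
    (diff k) (diff i) (diff_bag (diff i) ts) 
    (fun a => diff_bag (diff k.+1) ts (map (lift i) a)) (diff_bag (diff k)) (diff_bag (diff i))
    (fun vs us g => IHs i k vs us g ik) db vs us (fun s' r => g (App s' r))).
  apply: eq_sum_splits => a b; rewrite diff_App sum_diff_app sum_splits_map.
  apply: eq_sum_splits => a1 a2; apply: eq_bigr => x _; apply: eq_bigr => y _.
  by apply: eq_bigr => v _; rewrite diff_App sum_diff_app.
- rewrite /= big_map; under eq_bigr => r _ do rewrite /= big_map.
  rewrite IH //; apply: eq_sum_splits => a b; rewrite big_map.
  by apply: eq_bigr => t' _; apply: eq_bigr => v _; rewrite /= big_map.
- rewrite /= big_map; under eq_bigr => r _ do rewrite /= big_map.
  rewrite IH //; apply: eq_sum_splits => a b; rewrite big_map.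
  by apply: eq_bigr => t' _; apply: eq_bigr => v _; rewrite /= big_map.
Qed.

(** * Reduction steps and derivatives *)

Lemma step_lift :
  (forall t T, step t T -> forall k, step (lift k t) (map (lift k) T)) /\
  (forall ts T, step_bag ts T ->
     forall k, step_bag (map (lift k) ts) (map (map (lift k)) T)).
Proof.
apply: step_step_bag_ind => //=; try by [move=> *; constructor].
- by move=> s ts k; rewrite -lift_diff_above //; constructor.
- move=> s S _ IH k; have := step_Lam (IH k.+1); by rewrite -!map_comp.
- move=> s S ts _ IH k; have := step_App_l (map (lift k) ts) (IH k); by rewrite -!map_comp.
- move=> s ts T _ IH k; have := step_App_r (lift k s) (IH k); by rewrite -!map_comp.
- move=> s S _ IH k; have := step_Inl (IH k); by rewrite -!map_comp.
- move=> s S _ IH k; have := step_Inr (IH k); by rewrite -!map_comp.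
- move=> ts1 t ts2 T _ IH k; rewrite map_cat /=.
  have := step_bag_elt (map (lift k) ts1) (map (lift k) ts2) (IH k).
  by rewrite -!map_comp; congr step_bag; apply: eq_map => u /=; rewrite map_cat.
Qed.

(** Invariance of [g], extended additively to sums, under the steps from [t]. The coefficient of a
    fixed term in the normal form is the intended [g]. *)
Definition step_inv (g : rterm -> nat) (t : rterm) : Prop :=
  forall T, step t T -> g t = \sum_(r <- T) g r.

Definition step_bag_inv (G : bag -> nat) (ts : bag) : Prop :=
  forall T, step_bag ts T -> G ts = \sum_(r <- T) G r.

Lemma step_inv_Lam g s : step_inv g (Lam s) -> step_inv (g \o Lam) s.
Proof. by move=> gs S /step_Lam/gs; rewrite big_map. Qed.

Lemma step_inv_Inl g s : step_inv g (Inl s) -> step_inv (g \o Inl) s.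
Proof. by move=> gs S /step_Inl/gs; rewrite big_map. Qed.

Lemma step_inv_Inr g s : step_inv g (Inr s) -> step_inv (g \o Inr) s.
Proof. by move=> gs S /step_Inr/gs; rewrite big_map. Qed.

Lemma step_inv_App_l g s ts : step_inv g (App s ts) -> step_inv (g \o App^~ ts) s.
Proof. by move=> gs S /(step_App_l ts)/gs; rewrite big_map. Qed.

Lemma step_inv_App_r g s ts : step_inv g (App s ts) -> step_bag_inv (g \o App s) ts.
Proof. by move=> gs T /(step_App_r s)/gs; rewrite big_map. Qed.

Lemma step_bag_cons t ts T : step_bag ts T -> step_bag (t :: ts) (map (cons t) T).
Proof.
case=> ts1 u ts2 U uU; have := step_bag_elt (t :: ts1) ts2 uU.
by rewrite -map_comp.
Qed.

Lemma step_bag_head t T ts : step t T -> step_bag (t :: ts) [seq t' :: ts | t' <- T].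
Proof. exact: (@step_bag_elt [::]). Qed.

Lemma step_bag_nilP T : ~ step_bag [::] T.
Proof. by move E: [::] => ts H; case: H E => -[]. Qed.

Lemma step_bag_consP t ts T : step_bag (t :: ts) T ->
  (exists2 T1, step t T1 & T = [seq t' :: ts | t' <- T1]) \/
  (exists2 T2, step_bag ts T2 & T = map (cons t) T2).
Proof.
move E: (t :: ts) => us H; case: H E => -[|v us1] u us2 U uU /= [-> ->].
  by left; exists U.
by right; exists [seq us1 ++ t' :: us2 | t' <- U]; rewrite -?map_comp //; constructor.
Qed.

Lemma step_bag_inv_head G t ts : step_bag_inv G (t :: ts) ->
  step_inv (fun t' => G (t' :: ts)) t.
Proof. by move=> Gt T /(step_bag_head ts)/Gt; rewrite big_map. Qed.

Lemma step_bag_inv_behead G t ts : step_bag_inv G (t :: ts) ->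
  step_bag_inv (fun r => G (t :: r)) ts.
Proof. by move=> Gt T /(step_bag_cons t)/Gt; rewrite big_map. Qed.

Lemma mem_diff_app d s ts us p s' r : p \in splits us ->
  s' \in d s p.1 -> r \in diff_bag d ts p.2 -> App s' r \in diff_app d s ts us.
Proof.
by move=> pP s'P rP; apply/flatten_mapP; exists p => //; apply/allpairsP; exists (s', r).
Qed.

Lemma mem_diff_bag_cons d t ts us p t' r : p \in splits us ->
  t' \in d t p.1 -> r \in diff_bag d ts p.2 -> t' :: r \in diff_bag d (t :: ts) us.
Proof.
by move=> pP s'P rP; apply/flatten_mapP; exists p => //; apply/allpairsP; exists (t', r).
Qed.

Lemma eq_sum_splits_in us F G :
  (forall a b, (a, b) \in splits us -> F a b = G a b) ->
  sum_splits us F = sum_splits us G.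
Proof. by move=> FG; apply: eq_big_seq => -[a b] /FG. Qed.

Lemma mem_splits_cat us vs p q : p \in splits us -> q \in splits vs ->
  (p.1 ++ q.1, p.2 ++ q.2) \in splits (us ++ vs).
Proof.
elim: us p => [|u us IH] p /=; first by rewrite inE => /eqP->; case: q.
rewrite !mem_cat => /orP[] /mapP[p' p'P -> qP] /=; apply/orP; [left|right];
  by apply/mapP; exists (p'.1 ++ q.1, p'.2 ++ q.2) => //; apply: IH.
Qed.

Lemma mem_splits_midl us u vs a b c e : (a, b) \in splits us -> (c, e) \in splits vs ->
  (a ++ u :: c, b ++ e) \in splits (us ++ u :: vs).
Proof.
move=> pP qP; apply: (@mem_splits_cat us (u :: vs) (a, b) (u :: c, e)) => //=.
by rewrite mem_cat; apply/orP; left; apply/mapP; exists (c, e).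
Qed.

Lemma mem_splits_midr us u vs a b c e : (a, b) \in splits us -> (c, e) \in splits vs ->
  (a ++ c, b ++ u :: e) \in splits (us ++ u :: vs).
Proof.
move=> pP qP; apply: (@mem_splits_cat us (u :: vs) (a, b) (c, u :: e)) => //=.
by rewrite mem_cat; apply/orP; right; apply/mapP; exists (c, e).
Qed.


(** Every splitting sends [u] to exactly one of the two sides, and the step is performed there. *)
Lemma step_sum_pair_arg (X : bag -> seq rterm) (Y : bag -> seq bag) u U us vs
    (G : rterm -> bag -> nat) :
  (forall us vs (g : rterm -> nat),
    (forall r, r \in X (us ++ u :: vs) -> step_inv g r) ->
    \sum_(r <- X (us ++ u :: vs)) g r =
    \sum_(u' <- U) \sum_(r <- X (us ++ u' :: vs)) g r) ->
  (forall us vs (H : bag -> nat),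
    (forall r, r \in Y (us ++ u :: vs) -> step_bag_inv H r) ->
    \sum_(r <- Y (us ++ u :: vs)) H r =
    \sum_(u' <- U) \sum_(r <- Y (us ++ u' :: vs)) H r) ->
  (forall p x y, p \in splits (us ++ u :: vs) -> x \in X p.1 -> y \in Y p.2 ->
    step_inv (G^~ y) x /\ step_bag_inv (G x) y) ->
  sum_splits (us ++ u :: vs) (fun a b => \sum_(x <- X a) \sum_(y <- Y b) G x y) =
  \sum_(u' <- U) sum_splits (us ++ u' :: vs)
    (fun a b => \sum_(x <- X a) \sum_(y <- Y b) G x y).
Proof.
move=> HX HY HG; rewrite sum_splits_mid.
under [RHS]eq_bigr => u' _ do rewrite sum_splits_mid.
rewrite -sum_splits_sum; apply: eq_sum_splits_in => a b abP.
rewrite -sum_splits_sum; apply: eq_sum_splits_in => c e ceP.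
rewrite big_split /=; congr (_ + _); last first.
  rewrite [RHS]exchange_big /=; apply: eq_big_seq => x xP.
  rewrite HY // => y yP.
  by have [] := HG _ x y (mem_splits_midr u abP ceP) xP yP.
rewrite exchange_big /=; under [RHS]eq_bigr => u' _ do rewrite exchange_big /=.
rewrite [RHS]exchange_big /=; apply: eq_big_seq => y yP.
rewrite HX // => x xP.
by have [] := HG _ x y (mem_splits_midl u abP ceP) xP yP.
Qed.

Lemma step_diff_bag_arg d u U ts us vs (G : bag -> nat) :
  (forall t, t \in ts -> forall us vs (g : rterm -> nat),
    (forall r, r \in d t (us ++ u :: vs) -> step_inv g r) ->
    \sum_(r <- d t (us ++ u :: vs)) g r =
    \sum_(u' <- U) \sum_(r <- d t (us ++ u' :: vs)) g r) ->
  (forall r, r \in diff_bag d ts (us ++ u :: vs) -> step_bag_inv G r) ->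
  \sum_(r <- diff_bag d ts (us ++ u :: vs)) G r =
  \sum_(u' <- U) \sum_(r <- diff_bag d ts (us ++ u' :: vs)) G r.
Proof.
elim: ts us vs G => [|t ts IH] us vs G dts GP.
  rewrite sum_diff_bag_nil; under eq_bigr => u' _ do rewrite sum_diff_bag_nil.
  by case: us {GP} => [|u0 us]; rewrite big1_eq.
have {}IH us' vs' G' := IH us' vs' G' (fun t' t'P => dts t' (@mem_behead _ (t :: ts) t' t'P)).
rewrite sum_diff_bag_cons (step_sum_pair_arg (dts t (mem_head t ts)) IH) //.
  by apply: eq_bigr => u' _; rewrite sum_diff_bag_cons.
move=> p x y pP xP yP; have := GP _ (mem_diff_bag_cons pP xP yP).
by split; [apply: step_bag_inv_head|apply: step_bag_inv_behead].
Qed.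

(** Linearity: every summand of the derivative contains exactly one copy of [u] coming from the
    argument, so one step in each summand performs the reduction of [u]. *)
Lemma step_diff_arg u U k t us vs (g : rterm -> nat) : step u U ->
  (forall r, r \in diff k t (us ++ u :: vs) -> step_inv g r) ->
  \sum_(r <- diff k t (us ++ u :: vs)) g r =
  \sum_(u' <- U) \sum_(r <- diff k t (us ++ u' :: vs)) g r.
Proof.
elim/rterm_ind_in: t u U k us vs g => [x|s IH|s ts IHs IHts|s IH|s IH] u U k us vs g uU gP.
- case: us gP => [|u0 us] /=; last first.
    by case: (x == k); case: us => [|u1 us]; rewrite big_nil big1 // => *; rewrite big_nil.
  case: (x == k); last by rewrite big_nil big1 // => *; rewrite big_nil.
  case: vs => [|v vs] gP; last by rewrite big_nil big1 // => *; rewrite big_nil.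
  rewrite big_seq1 (gP u (mem_head _ _) _ uU).
  by apply: eq_bigr => u' _; rewrite big_seq1.
- rewrite /= big_map map_cat /= (IH _ _ _ _ _ (g \o Lam) (step_lift.1 _ _ uU 0)).
    by rewrite big_map; apply: eq_bigr => u' _; rewrite /= big_map map_cat.
  move=> r rP; apply: step_inv_Lam; apply: gP => /=.
  by apply: map_f; rewrite map_cat.
- rewrite diff_App sum_diff_app.
  rewrite (step_sum_pair_arg (fun us vs g => IHs u U k us vs g uU)
    (fun us vs H => step_diff_bag_arg (fun t tP us vs g => IHts t tP u U k us vs g uU))).
    by apply: eq_bigr => u' _; rewrite diff_App sum_diff_app.
  move=> p x y pP xP yP; have := gP _ (mem_diff_app pP xP yP).
  by split; [apply: step_inv_App_l|apply: step_inv_App_r].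
- rewrite /= big_map (IH _ _ _ _ _ (g \o Inl) uU).
    by apply: eq_bigr => u' _; rewrite /= big_map.
  by move=> r rP; apply: step_inv_Inl; apply: gP => /=; apply: map_f.
- rewrite /= big_map (IH _ _ _ _ _ (g \o Inr) uU).
    by apply: eq_bigr => u' _; rewrite /= big_map.
  by move=> r rP; apply: step_inv_Inr; apply: gP => /=; apply: map_f.
Qed.

(** A redex of [t] leaves exactly one redex in each summand of the derivative, and firing it
    commutes with deriving. For a beta-redex this is [sum_diff_diff]. *)
Lemma step_diff :
  (forall t T, step t T -> forall k us (g : rterm -> nat),
    (forall r, r \in diff k t us -> step_inv g r) ->
    \sum_(r <- diff k t us) g r = \sum_(t' <- T) \sum_(r <- diff k t' us) g r) /\
  (forall ts T, step_bag ts T -> forall k us (G : bag -> nat),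
    (forall r, r \in diff_bag (diff k) ts us -> step_bag_inv G r) ->
    \sum_(r <- diff_bag (diff k) ts us) G r =
    \sum_(ts' <- T) \sum_(r <- diff_bag (diff k) ts' us) G r).
Proof.
apply: step_step_bag_ind.
- move=> s ts k us g gP; rewrite sum_diff_diff // diff_App sum_diff_app.
  apply: eq_sum_splits_in => a b abP; rewrite big_map; apply: eq_big_seq => s' s'P.
  apply: eq_big_seq => r rP; apply: gP (step_beta _ _).
  by rewrite diff_App; apply: (mem_diff_app abP) => //=; apply: map_f.
- move=> s ts k us g gP; rewrite big_seq1 diff_Inl big_map !diff_App !sum_diff_app.
  apply: eq_sum_splits_in => a b abP; rewrite big_map; apply: eq_big_seq => s' s'P.
  apply: eq_big_seq => r rP; rewrite (gP _ _ _ (step_App_Inl _ _)) ?big_seq1 //.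
  by rewrite diff_App; apply: (mem_diff_app abP) => //=; apply: map_f.
- move=> s ts k us g gP; rewrite big_seq1 diff_Inr big_map !diff_App !sum_diff_app.
  apply: eq_sum_splits_in => a b abP; rewrite big_map; apply: eq_big_seq => s' s'P.
  apply: eq_big_seq => r rP; rewrite (gP _ _ _ (step_App_Inr _ _)) ?big_seq1 //.
  by rewrite diff_App; apply: (mem_diff_app abP) => //=; apply: map_f.
- move=> s k us g gP; rewrite big_seq1 /= !big_map; apply: eq_big_seq => s' s'P.
  rewrite (gP _ _ _ (step_Lam_Inl _)) ?big_seq1 //=.
  by do 2!apply: map_f.
- move=> s k us g gP; rewrite big_seq1 /= !big_map; apply: eq_big_seq => s' s'P.
  rewrite (gP _ _ _ (step_Lam_Inr _)) ?big_seq1 //=.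
  by do 2!apply: map_f.
- move=> s S _ IH k us g gP; rewrite /= !big_map (IH _ _ (g \o Lam)).
    by apply: eq_bigr => s' _; rewrite /= big_map.
  by move=> r rP; apply: step_inv_Lam; apply: gP => /=; apply: map_f.
- move=> s S ts _ IH k us g gP; rewrite diff_App sum_diff_app big_map.
  under [RHS]eq_bigr => s' _ do rewrite diff_App sum_diff_app.
  rewrite -sum_splits_sum; apply: eq_sum_splits_in => a b abP.
  rewrite exchange_big /=; under [RHS]eq_bigr => s' _ do rewrite exchange_big /=.
  rewrite [RHS]exchange_big /=; apply: eq_big_seq => r rP.
  rewrite IH // => s' s'P; apply: step_inv_App_l; apply: gP.
  exact: (mem_diff_app abP).
- move=> s ts T _ IH k us g gP; rewrite diff_App sum_diff_app big_map.
  under [RHS]eq_bigr => s' _ do rewrite diff_App sum_diff_app.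
  rewrite -sum_splits_sum; apply: eq_sum_splits_in => a b abP.
  rewrite [RHS]exchange_big /=; apply: eq_big_seq => s' s'P.
  rewrite IH // => r rP; apply: step_inv_App_r; apply: gP.
  exact: (mem_diff_app abP).
- move=> s S _ IH k us g gP; rewrite /= !big_map (IH _ _ (g \o Inl)).
    by apply: eq_bigr => s' _; rewrite /= big_map.
  by move=> r rP; apply: step_inv_Inl; apply: gP => /=; apply: map_f.
- move=> s S _ IH k us g gP; rewrite /= !big_map (IH _ _ (g \o Inr)).
    by apply: eq_bigr => s' _; rewrite /= big_map.
  by move=> r rP; apply: step_inv_Inr; apply: gP => /=; apply: map_f.
- move=> ts1 t ts2 T _ IH k us G; rewrite big_map.
  elim: ts1 us G => [|t1 ts1 IHts] us G GP.
    rewrite sum_diff_bag_cons; under [RHS]eq_bigr => t' _ do rewrite sum_diff_bag_cons.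
    rewrite -sum_splits_sum; apply: eq_sum_splits_in => a b abP.
    rewrite exchange_big /=; under [RHS]eq_bigr => s' _ do rewrite exchange_big /=.
    rewrite [RHS]exchange_big /=; apply: eq_big_seq => r rP.
    rewrite IH // => s' s'P; apply: (@step_bag_inv_head G); apply: GP.
    exact: (mem_diff_bag_cons abP).
  rewrite cat_cons sum_diff_bag_cons; under [RHS]eq_bigr => t' _ do rewrite sum_diff_bag_cons.
  rewrite -sum_splits_sum; apply: eq_sum_splits_in => a b abP.
  rewrite [RHS]exchange_big /=; apply: eq_big_seq => t' t'P.
  rewrite IHts // => r rP; apply: step_bag_inv_behead; apply: GP.
  exact: (mem_diff_bag_cons abP).
Qed.

(** * Confluence *)

(** The hypothesis available about [g] while its invariance is proved by induction on [meas]. *)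
Definition inv_below (g : rterm -> nat) (t : rterm) : Prop :=
  forall r, decr (meas r) (meas t) -> step_inv g r.

Definition bag_inv_below (G : bag -> nat) (ts : bag) : Prop :=
  forall r, decr (meas_bag r) (meas_bag ts) -> step_bag_inv G r.

Lemma decr_trans : transitive decr.
Proof. move=> [[? ?] ?] [[? ?] ?] [[? ?] ?]; rewrite /decr /=; lia. Qed.

Lemma inv_below_step g t T r :
  inv_below g t -> step t T -> r \in T -> step_inv g r.
Proof. by move=> gt tT rT; apply: gt; apply: step_decr.1 tT _ rT. Qed.

Lemma inv_below_trans g t r :
  inv_below g t -> decr (meas r) (meas t) -> inv_below g r.
Proof. by move=> gt rt u ur; apply: gt; apply: decr_trans ur rt. Qed.

Lemma inv_below_Lam g s : inv_below g (Lam s) -> inv_below (g \o Lam) s.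
Proof.
move=> gs r rs; apply: step_inv_Lam; apply: gs; move: rs; rewrite /decr /=; lia.
Qed.

Lemma inv_below_Inl g s : inv_below g (Inl s) -> inv_below (g \o Inl) s.
Proof.
move=> gs r rs; apply: step_inv_Inl; apply: gs; move: rs; rewrite /decr /=; lia.
Qed.

Lemma inv_below_Inr g s : inv_below g (Inr s) -> inv_below (g \o Inr) s.
Proof.
move=> gs r rs; apply: step_inv_Inr; apply: gs; move: rs; rewrite /decr /=; lia.
Qed.

Lemma inv_below_App_l g s ts : inv_below g (App s ts) -> inv_below (g \o App^~ ts) s.
Proof.
move=> gs r rs; apply: step_inv_App_l; apply: gs; move: rs; rewrite /decr /=; lia.
Qed.

Lemma inv_below_App_r g s ts : inv_below g (App s ts) -> bag_inv_below (g \o App s) ts.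
Proof.
move=> gs r rs; apply: step_inv_App_r; apply: gs; move: rs; rewrite /decr /=; lia.
Qed.

Lemma bag_inv_below_head G t ts : bag_inv_below G (t :: ts) ->
  inv_below (fun t' => G (t' :: ts)) t.
Proof.
move=> Gt r rs; apply: (@step_bag_inv_head G); apply: Gt; move: rs; rewrite /decr /=; lia.
Qed.

Lemma bag_inv_below_behead G t ts : bag_inv_below G (t :: ts) ->
  bag_inv_below (fun r => G (t :: r)) ts.
Proof.
move=> Gt r rs; apply: (@step_bag_inv_behead G); apply: Gt; move: rs; rewrite /decr /=; lia.
Qed.

Lemma step_VarP x T : ~ step (Var x) T.
Proof. by move=> H; inversion H. Qed.

Lemma step_LamP s T : step (Lam s) T ->
  [\/ exists2 s0, s = Inl s0 & T = [:: Inl (Lam s0)],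
      exists2 s0, s = Inr s0 & T = [:: Inr (Lam s0)] |
      exists2 S, step s S & T = map Lam S].
Proof.
move=> H; inversion H; subst; [constructor 1|constructor 2|constructor 3]; eexists; eauto.
Qed.

Lemma step_InlP s T : step (Inl s) T -> exists2 S, step s S & T = map Inl S.
Proof. move=> H; inversion H; subst; eexists; eauto. Qed.

Lemma step_InrP s T : step (Inr s) T -> exists2 S, step s S & T = map Inr S.
Proof. move=> H; inversion H; subst; eexists; eauto. Qed.

Definition head_step (s : rterm) (ts : bag) : option (seq rterm) :=
  match s with
  | Lam u => Some (diff 0 u ts)
  | Inl u => Some [:: Inl (App u ts)]
  | Inr u => Some [:: Inr (App u ts)]
  | _ => None
  end.

Lemma step_AppP s ts T : step (App s ts) T ->
  [\/ head_step s ts = Some T,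
      exists2 S, step s S & T = [seq App s' ts | s' <- S] |
      exists2 T', step_bag ts T' & T = map (App s) T'].
Proof.
move=> H; inversion H; subst; try (by constructor 1).
- by constructor 2; eexists; eauto.
- by constructor 3; eexists; eauto.
Qed.

(** A step other than the one at the root takes place inside [s]; it can be performed after the root
    step as well, and the root step can be performed after it. *)
Lemma step_Lam_Inl_unique g s T : inv_below g (Lam (Inl s)) ->
  step (Lam (Inl s)) T -> \sum_(r <- T) g r = g (Inl (Lam s)).
Proof.
move=> gs sT; case/step_LamP: (sT) => [[_ [<-] ->]|[] //|[S /step_InlP[S0 sS0 ->] TE]].
  by rewrite big_seq1.
rewrite (inv_below_step gs (step_Lam_Inl s) (mem_head _ _) (step_Inl (step_Lam sS0))).
rewrite TE -!map_comp !big_map; apply: eq_big_seq => s' s'P.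
rewrite (inv_below_step gs sT _ (step_Lam_Inl s')) ?big_seq1 //.
by rewrite TE -map_comp; apply: (map_f (Lam \o Inl)).
Qed.

Lemma step_Lam_Inr_unique g s T : inv_below g (Lam (Inr s)) ->
  step (Lam (Inr s)) T -> \sum_(r <- T) g r = g (Inr (Lam s)).
Proof.
move=> gs sT; case/step_LamP: (sT) => [[] //|[_ [<-] ->]|[S /step_InrP[S0 sS0 ->] TE]].
  by rewrite big_seq1.
rewrite (inv_below_step gs (step_Lam_Inr s) (mem_head _ _) (step_Inr (step_Lam sS0))).
rewrite TE -!map_comp !big_map; apply: eq_big_seq => s' s'P.
rewrite (inv_below_step gs sT _ (step_Lam_Inr s')) ?big_seq1 //.
by rewrite TE -map_comp; apply: (map_f (Lam \o Inr)).
Qed.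

Lemma step_App_Inl_unique g s ts T : inv_below g (App (Inl s) ts) ->
  step (App (Inl s) ts) T -> \sum_(r <- T) g r = g (Inl (App s ts)).
Proof.
move=> gs sT; have gV := inv_below_step gs (step_App_Inl s ts) (mem_head _ _).
case/step_AppP: (sT) => [[<-]|[S sS TE]|[T' tsT' TE]].
- by rewrite big_seq1.
- have [S0 sS0 SE] := step_InlP sS.
  rewrite (gV _ (step_Inl (step_App_l ts sS0))) TE SE -!map_comp !big_map.
  apply: eq_big_seq => s' s'P.
  rewrite (inv_below_step gs sT _ (step_App_Inl s' ts)) ?big_seq1 //.
  by rewrite TE SE -map_comp; apply: (map_f (App^~ ts \o Inl)).
- rewrite (gV _ (step_Inl (step_App_r s tsT'))) TE -map_comp !big_map.
  apply: eq_big_seq => r rP.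
  rewrite (inv_below_step gs sT _ (step_App_Inl s r)) ?big_seq1 //.
  by rewrite TE; apply: map_f.
Qed.

Lemma step_App_Inr_unique g s ts T : inv_below g (App (Inr s) ts) ->
  step (App (Inr s) ts) T -> \sum_(r <- T) g r = g (Inr (App s ts)).
Proof.
move=> gs sT; have gV := inv_below_step gs (step_App_Inr s ts) (mem_head _ _).
case/step_AppP: (sT) => [[<-]|[S sS TE]|[T' tsT' TE]].
- by rewrite big_seq1.
- have [S0 sS0 SE] := step_InrP sS.
  rewrite (gV _ (step_Inr (step_App_l ts sS0))) TE SE -!map_comp !big_map.
  apply: eq_big_seq => s' s'P.
  rewrite (inv_below_step gs sT _ (step_App_Inr s' ts)) ?big_seq1 //.
  by rewrite TE SE -map_comp; apply: (map_f (App^~ ts \o Inr)).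
- rewrite (gV _ (step_Inr (step_App_r s tsT'))) TE -map_comp !big_map.
  apply: eq_big_seq => r rP.
  rewrite (inv_below_step gs sT _ (step_App_Inr s r)) ?big_seq1 //.
  by rewrite TE; apply: map_f.
Qed.

Lemma step_App_Lam_unique g s ts T : inv_below g (App (Lam s) ts) ->
  step (App (Lam s) ts) T -> \sum_(r <- T) g r = \sum_(r <- diff 0 s ts) g r.
Proof.
move=> gs sT; have gV r := inv_below_step gs (step_beta s ts) (r := r).
case/step_AppP: (sT) => [[<-] //|[S sS TE]|[T' tsT' TE]].
- case/step_LamP: sS TE => [[s0 s0E ->]|[s0 s0E ->]|[S0 sS0 ->]] TE.
  (* This critical pair, like its [Inr] counterpart, needs two steps on one side:
     [App (Inl (Lam s0)) ts] goes to [Inl (App (Lam s0) ts)], and then to the derivative under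
     [Inl]. *)
  + have d1 := step_decr.1 _ _ sT (App (Inl (Lam s0)) ts); rewrite TE inE eqxx in d1.
    rewrite TE s0E diff_Inl big_map big_seq1.
    rewrite (gs _ (d1 isT) _ (step_App_Inl _ _)) big_seq1.
    have := inv_below_step (inv_below_trans gs (d1 isT)) (step_App_Inl _ _) (mem_head _ _).
    by move=> /(_ _ (step_Inl (step_beta s0 ts))) ->; rewrite big_map.
  + have d1 := step_decr.1 _ _ sT (App (Inr (Lam s0)) ts); rewrite TE inE eqxx in d1.
    rewrite TE s0E diff_Inr big_map big_seq1.
    rewrite (gs _ (d1 isT) _ (step_App_Inr _ _)) big_seq1.
    have := inv_below_step (inv_below_trans gs (d1 isT)) (step_App_Inr _ _) (mem_head _ _).
    by move=> /(_ _ (step_Inr (step_beta s0 ts))) ->; rewrite big_map.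
  + rewrite (step_diff.1 _ _ sS0) // TE -map_comp big_map; apply: eq_big_seq => s' s'P.
    apply: (inv_below_step gs sT _ (step_beta s' ts)).
    by rewrite TE -map_comp; apply: (map_f (App^~ ts \o Lam)).
- case: tsT' TE gs sT gV => ts1 t ts2 U tU TE gs sT gV.
  rewrite (step_diff_arg tU) // TE -map_comp big_map; apply: eq_big_seq => t' t'P.
  apply: (inv_below_step gs sT _ (step_beta s (ts1 ++ t' :: ts2))).
  by rewrite TE -map_comp; apply: (map_f (App (Lam s) \o (fun t' => ts1 ++ t' :: ts2))).
Qed.

Lemma step_bag_unique ts G T1 T2 :
  (forall t, t \in ts -> forall g T1 T2, inv_below g t -> step t T1 -> step t T2 ->
     \sum_(r <- T1) g r = \sum_(r <- T2) g r) ->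
  bag_inv_below G ts -> step_bag ts T1 -> step_bag ts T2 ->
  \sum_(r <- T1) G r = \sum_(r <- T2) G r.
Proof.
elim: ts G T1 T2 => [|t ts IH] G T1 T2 lc GP; first by move=> /step_bag_nilP.
have gP := bag_inv_below_head GP; have GP' := bag_inv_below_behead GP.
have com A B : step t A -> step_bag ts B ->
    \sum_(t' <- A) G (t' :: ts) = \sum_(r <- B) G (t :: r).
  move=> tA tsB.
  transitivity (\sum_(t' <- A) \sum_(r <- B) G (t' :: r)).
    apply: eq_big_seq => t' t'P.
    have d : decr (meas_bag (t' :: ts)) (meas_bag (t :: ts)).
      by have := step_decr.1 _ _ tA _ t'P; rewrite /decr /=; lia.
    by rewrite (GP _ d _ (step_bag_cons t' tsB)) big_map.
  rewrite exchange_big /=; apply: eq_big_seq => r rP.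
  have d : decr (meas_bag (t :: r)) (meas_bag (t :: ts)).
    by have := step_decr.2 _ _ tsB _ rP; rewrite /decr /=; lia.
  by rewrite (GP _ d _ (step_bag_head r tA)) big_map.
case/step_bag_consP=> [[A tA ->]|[A tA ->]]; case/step_bag_consP=> [[B tB ->]|[B tB ->]];
  rewrite !big_map.
- exact: (lc t (mem_head _ _) _ _ _ gP).
- exact: com.
- by apply/esym/com.
- by apply: IH tA tB => // u uts; apply: lc; rewrite inE uts orbT.
Qed.

(** Local confluence seen through [g]: either one of the rules applies at the root, and the lemmas
    above compare every step with it, or the two steps lie in one subterm, or they lie in disjoint
    subterms and commute. *)
Lemma step_unique t g T1 T2 : inv_below g t -> step t T1 -> step t T2 ->
  \sum_(r <- T1) g r = \sum_(r <- T2) g r.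
Proof.
elim/rterm_ind_in: t g T1 T2 => [x|s IH|s ts IHs IHts|s IH|s IH] g T1 T2 gP.
- by move/step_VarP.
- move=> s1 s2; case/step_LamP: (s1) gP => [[s0 sE _]|[s0 sE _]|[S1 sS1 E1]] gP.
  + by rewrite sE in s1 s2 gP; rewrite (step_Lam_Inl_unique gP s1) (step_Lam_Inl_unique gP s2).
  + by rewrite sE in s1 s2 gP; rewrite (step_Lam_Inr_unique gP s1) (step_Lam_Inr_unique gP s2).
  case/step_LamP: (s2) gP => [[s0 sE _]|[s0 sE _]|[S2 sS2 E2]] gP.
  + by rewrite sE in s1 s2 gP; rewrite (step_Lam_Inl_unique gP s1) (step_Lam_Inl_unique gP s2).
  + by rewrite sE in s1 s2 gP; rewrite (step_Lam_Inr_unique gP s1) (step_Lam_Inr_unique gP s2).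
  by rewrite E1 E2 !big_map; apply: IH sS1 sS2; apply: inv_below_Lam.
- move=> s1 s2.
  have com A B : step s A -> step_bag ts B ->
      \sum_(s' <- A) g (App s' ts) = \sum_(r <- B) g (App s r).
    move=> sA tsB.
    transitivity (\sum_(s' <- A) \sum_(r <- B) g (App s' r)).
      apply: eq_big_seq => s' s'P.
      have d := step_decr.1 _ _ (step_App_l ts sA) _ (map_f (App^~ ts) s'P).
      by rewrite (gP _ d _ (step_App_r s' tsB)) big_map.
    rewrite exchange_big /=; apply: eq_big_seq => r rP.
    have d := step_decr.1 _ _ (step_App_r s tsB) _ (map_f (App s) rP).
    by rewrite (gP _ d _ (step_App_l r sA)) big_map.
  have [[A hA]|hN] : (exists A, head_step s ts = Some A) \/ head_step s ts = None.
  - by case: (head_step s ts) => [A|]; [left; exists A|right].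
  - case: s hA s1 s2 gP {IHs com} => //= u [AE] s1 s2 gP.
    + by rewrite (step_App_Lam_unique gP s1) (step_App_Lam_unique gP s2).
    + by rewrite (step_App_Inl_unique gP s1) (step_App_Inl_unique gP s2).
    + by rewrite (step_App_Inr_unique gP s1) (step_App_Inr_unique gP s2).
  case/step_AppP: s1 => [|[A sA ->]|[A sA ->]]; first by rewrite hN.
  + case/step_AppP: s2 => [|[B sB ->]|[B sB ->]]; first by rewrite hN.
    * by rewrite !big_map; apply: IHs sA sB; apply: inv_below_App_l.
    * by rewrite !big_map; apply: com.
  + case/step_AppP: s2 => [|[B sB ->]|[B sB ->]]; first by rewrite hN.
    * by rewrite !big_map; apply/esym/com.
    * rewrite !big_map; apply: (step_bag_unique IHts _ sA sB).
      exact: inv_below_App_r.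
- move=> /step_InlP[A sA ->] /step_InlP[B sB ->].
  by rewrite !big_map; apply: IH sA sB; apply: inv_below_Inl.
- move=> /step_InrP[A sA ->] /step_InrP[B sB ->].
  by rewrite !big_map; apply: IH sA sB; apply: inv_below_Inr.
Qed.

(* g t is the sum of f over the normal form of t; it is computed by some      *)
(* strategy, and local confluence makes it independent of the strategy.       *)
Lemma exists_step_inv (f : rterm -> nat) : exists2 g : rterm -> nat,
  (forall t, step_inv g t) & (forall t, (forall T, ~ step t T) -> g t = f t).
Proof.
(* The test of [decr] supplies the proof required by the recursive call; at [m = meas t] its default
   value 0 is excluded by [step_decr]. *)
pose F m (rec : forall m', decr m' m -> rterm -> nat) (t : rterm) : nat :=
  match excluded_middle_informative (exists T, step t T) with
  | left tT =>
      \sum_(r <- proj1_sig (constructive_indefinite_description _ tT))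
         match Sumbool.sumbool_of_bool (decr (meas r) m) with
         | left rt => rec (meas r) rt r
         | right _ => 0
         end
  | right _ => f t
  end.
pose h := Fix decr_wf (fun _ => rterm -> nat) F.
pose g t := h (meas t) t.
have hE m : h m = F m (fun m' _ => h m').
  apply: Fix_eq => {}m r1 r2 r12; apply: functional_extensionality => t.
  rewrite /F; case: excluded_middle_informative => // tT.
  by apply: eq_bigr => r _; case: Sumbool.sumbool_of_bool => // rt; rewrite r12.
have gN t : (forall T, ~ step t T) -> g t = f t.
  by move=> tN; rewrite /g hE /F; case: excluded_middle_informative => // tT; exfalso; case: tT => T /tN.
have gS t : (exists T, step t T) -> exists2 T, step t T & g t = \sum_(r <- T) g r.
  move=> tT; rewrite {1}/g hE /F; case: excluded_middle_informative => // {}tT.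
  case: constructive_indefinite_description => T sT /=; exists T => //.
  apply: eq_big_seq => r rT; by case: Sumbool.sumbool_of_bool; rewrite ?(step_decr.1 _ _ sT).
exists g => // t; move: {2}(meas t) (erefl (meas t)) => m.
elim: m / (decr_wf m) t => m _ IH t tm T tT.
have [|T0 tT0 ->] := gS t; first by exists T.
by apply: step_unique tT0 tT => r rt; apply: IH (erefl _); rewrite -tm.
Qed.

(** * Derivatives up to permutations *)

Definition bag_eq (us us' : bag) : bool := perm_eq (map canon us) (map canon us').

Lemma bag_eq_refl us : bag_eq us us. Proof. exact: perm_refl. Qed.

Lemma bag_eq_sym us us' : bag_eq us us' = bag_eq us' us.
Proof. exact: perm_sym. Qed.

Lemma bag_eq_trans us1 us2 us3 : bag_eq us1 us2 -> bag_eq us2 us3 -> bag_eq us1 us3.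
Proof. exact: perm_trans. Qed.

Lemma perm_bag_eq us us' : perm_eq us us' -> bag_eq us us'.
Proof. exact: perm_map. Qed.

Lemma bag_eq_cat us us' vs vs' :
  bag_eq us us' -> bag_eq vs vs' -> bag_eq (us ++ vs) (us' ++ vs').
Proof. by rewrite /bag_eq !map_cat; apply: perm_cat. Qed.

Lemma bag_eq_cons u u' us us' : canon u = canon u' ->
  bag_eq (u :: us) (u' :: us') = bag_eq us us'.
Proof. by rewrite /bag_eq /= => ->; rewrite perm_cons. Qed.

Lemma bag_eq_catl us us' vs vs' : bag_eq us us' ->
  bag_eq (us ++ vs) (us' ++ vs') -> bag_eq vs vs'.
Proof.
rewrite /bag_eq !map_cat => uu' uv; rewrite -(perm_cat2l (map canon us)).
by rewrite (perm_trans uv) // perm_cat2r perm_sym.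
Qed.

Lemma mem_map_split (T U : eqType) (f : T -> U) y s : y \in map f s ->
  exists s1 x s2, s = s1 ++ x :: s2 /\ f x = y.
Proof.
case/mapP=> x; case/splitPr=> s1 s2 ->; by exists s1, x, s2.
Qed.

Lemma bag_eq_consP u us us' : bag_eq (u :: us) us' ->
  exists c u' e, [/\ us' = c ++ u' :: e, canon u' = canon u & bag_eq us (c ++ e)].
Proof.
move=> uus; have /mem_map_split[c [u' [e [us'E u'u]]]] : canon u \in map canon us'.
  by rewrite -(perm_mem uus) mem_head.
exists c, u', e; split => //; move: uus; rewrite /bag_eq us'E !map_cat /= u'u => uus.
by rewrite -(perm_cons (canon u)) (perm_trans uus) // -cat1s perm_catCA.
Qed.

(** Passes from elements to multisets the fact that [f] determines [h], for instance that a reduct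
    determines its origin. *)
Lemma perm_map_factor (T U V : eqType) (f : T -> U) (h : T -> V) xs ys :
  (forall x y, x \in xs -> y \in ys -> f x = f y -> h x = h y) ->
  perm_eq (map f xs) (map f ys) -> perm_eq (map h xs) (map h ys).
Proof.
elim: xs ys => [|x xs IH] ys fh.
  by move=> /perm_size; case: ys {fh}.
move=> xys; have /mem_map_split[c [y [e [ysE yx]]]] : f x \in map f ys.
  by rewrite -(perm_mem xys) mem_head.
have xyh : h x = h y by apply: fh; rewrite ?mem_head // ysE mem_cat mem_head orbT.
rewrite ysE map_cat /= -xyh perm_sym -cat1s perm_catCA /= perm_cons -map_cat perm_sym.
apply: IH => [x' y' x'P y'P|].
  apply: fh; rewrite ?inE ?x'P ?orbT // ysE; move: y'P.
  by rewrite !mem_cat inE => /orP[->|->]; rewrite ?orbT.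
move: xys; rewrite ysE !map_cat /= yx => xys.
by rewrite -(perm_cons (f x)) (perm_trans xys) // -cat1s perm_catCA.
Qed.

Lemma canon_liftP k t t' : canon (lift k t) = canon (lift k t') <-> canon t = canon t'.
Proof.
elim/rterm_ind_in: t t' k => [x|s IH|s ts IHs IHts|s IH|s IH] [y|s'|s' ts'|s'|s'] k //=.
- by split=> [[/(can_inj (@bumpK _)) ->]|[->]].
- by split=> [[/IH ->]|[/IH ->]].
- split=> -[/IHs -> /canon_bagP ts12]; congr App; apply/canon_bagP; move: ts12;
    rewrite -!map_comp; apply: perm_map_factor => t t' tts _ /=; by rewrite IHts.
- by split=> [[/IH ->]|[/IH ->]].
- by split=> [[/IH ->]|[/IH ->]].
Qed.

Lemma bag_eq_lift k us us' : bag_eq (map (lift k) us) (map (lift k) us') = bag_eq us us'.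
Proof.
rewrite /bag_eq -!map_comp; apply/idP/idP;
  by apply: perm_map_factor => u u' _ _ /=; rewrite canon_liftP.
Qed.

Lemma sum_splits_bag_eq us us' F :
  (forall a a' b b', bag_eq a a' -> bag_eq b b' -> F a b = F a' b') ->
  bag_eq us us' -> sum_splits us F = sum_splits us' F.
Proof.
elim: us us' F => [|u us IH] us' F Feq.
  by move=> /perm_size; rewrite !size_map; case: us'.
case/bag_eq_consP=> c [u' [e [-> u'u us_ce]]].
rewrite sum_splits_mid sum_splits_cons -sum_splitsD.
rewrite (IH (c ++ e)) //; last first.
  by move=> a a' b b' aa' bb'; congr (_ + _); apply: Feq; rewrite ?bag_eq_cons.
rewrite sum_splits_cat; apply: eq_sum_splits => a b; apply: eq_sum_splits => a' b'.
congr (_ + _); apply: Feq; rewrite ?bag_eq_refl //.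
  by rewrite /bag_eq map_cat /= -u'u -map_cons perm_sym -cat1s perm_catCA /= map_cat.
by rewrite /bag_eq map_cat /= -u'u -map_cons perm_sym -cat1s perm_catCA /= map_cat.
Qed.

Section Generic.

Variable d : rterm -> bag -> seq rterm.

(** As [f] is arbitrary, the two sides are the same formal sum up to permutations. *)
Definition canon_inv t t' : Prop := forall us us', bag_eq us us' ->
  forall f : rterm -> nat,
  \sum_(r <- d t us) f (canon r) = \sum_(r <- d t' us') f (canon r).

Lemma sum_diff_bag_mid c t e us (F : bag -> nat) :
  (forall r r', perm_eq r r' -> F r = F r') ->
  \sum_(r <- diff_bag d (c ++ t :: e) us) F (map canon r) =
  \sum_(r <- diff_bag d (t :: c ++ e) us) F (map canon r).
Proof.
elim: c us F => [//|u c IH] us F Fperm; rewrite cat_cons sum_diff_bag_cons.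
under eq_sum_splits => a b.
  under eq_bigr => x _.
    rewrite (IH _ (fun r => F (canon x :: r))) => [|r r' rr']; last first.
      by apply: Fperm; rewrite perm_cons.
    rewrite sum_diff_bag_cons; over.
  rewrite -sum_splits_sum; over.
rewrite sum_splitsCA sum_diff_bag_cons; apply: eq_sum_splits => a b.
under [RHS]eq_bigr => x _ do rewrite sum_diff_bag_cons.
rewrite -sum_splits_sum; apply: eq_sum_splits => a' b'.
rewrite exchange_big /=; apply: eq_bigr => x _; apply: eq_bigr => y _.
apply: eq_bigr => r _; apply: Fperm => /=.
by apply/permPl; apply: (perm_catCA [:: _] [:: _]).
Qed.

Lemma diff_bag_canon ts ts' us us' (F : bag -> nat) :
  (forall t, t \in ts -> forall t', canon t = canon t' -> canon_inv t t') ->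
  (forall r r', perm_eq r r' -> F r = F r') ->
  bag_eq ts ts' -> bag_eq us us' ->
  \sum_(r <- diff_bag d ts us) F (map canon r) =
  \sum_(r <- diff_bag d ts' us') F (map canon r).
Proof.
elim: ts ts' us us' F => [|t ts IH] ts' us us' F dts Fperm.
  move=> /perm_size; rewrite !size_map; case: ts' => // _ /perm_size.
  by rewrite !size_map !sum_diff_bag_nil; case: us; case: us'.
have {}IH ts1 us1 us2 F1 := IH ts1 us1 us2 F1 (fun u uP => dts u (@mem_behead _ (t :: ts) u uP)).
have dt := dts t (mem_head _ _).
case/bag_eq_consP=> c [t' [e [-> t't ts_ce]]] uu'.
rewrite sum_diff_bag_mid // !sum_diff_bag_cons.
have H (t1 : rterm) ts1 a1 b1 a2 b2 : canon t = canon t1 -> bag_eq ts ts1 -> bag_eq a1 a2 ->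
    bag_eq b1 b2 ->
    \sum_(x <- d t a1) \sum_(r <- diff_bag d ts b1) F (map canon (x :: r)) =
    \sum_(x <- d t1 a2) \sum_(r <- diff_bag d ts1 b2) F (map canon (x :: r)).
  move=> tt1 tsts1 aa bb.
  rewrite (dt _ tt1 _ _ aa (fun c => \sum_(r <- diff_bag d ts b1) F (c :: map canon r))).
  apply: eq_bigr => x _; apply: (IH _ _ _ (fun r => F (canon x :: r))) => // r r' rr'.
  by apply: Fperm; rewrite perm_cons.
rewrite (sum_splits_bag_eq _ uu') => [|a a' b b' aa bb]; last first.
  by apply: H => //; apply: bag_eq_refl.
by apply: eq_sum_splits => a b; apply: H; rewrite ?bag_eq_refl.
Qed.

Lemma diff_app_canon s s' ts ts' us us' (f : rterm -> nat) :
  (forall s', canon s = canon s' -> canon_inv s s') ->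
  (forall t, t \in ts -> forall t', canon t = canon t' -> canon_inv t t') ->
  canon s = canon s' -> bag_eq ts ts' -> bag_eq us us' ->
  \sum_(r <- diff_app d s ts us) f (canon r) =
  \sum_(r <- diff_app d s' ts' us') f (canon r).
Proof.
move=> ds dts ss' tts' uu'; rewrite !sum_diff_app.
have H (s1 : rterm) ts1 a1 b1 a2 b2 : canon s = canon s1 -> bag_eq ts ts1 -> bag_eq a1 a2 ->
    bag_eq b1 b2 ->
    \sum_(x <- d s a1) \sum_(r <- diff_bag d ts b1) f (canon (App x r)) =
    \sum_(x <- d s1 a2) \sum_(r <- diff_bag d ts1 b2) f (canon (App x r)).
  move=> ss1 tts1 aa bb.
  rewrite (ds _ ss1 _ _ aa (fun c => \sum_(r <- diff_bag d ts b1) f (App c (canon_bag (map canon r))))).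
  apply: eq_bigr => x _; apply: (diff_bag_canon (F := fun r => f (App (canon x) (canon_bag r)))) => //.
  by move=> r r' /canon_bagP ->.
rewrite (sum_splits_bag_eq _ uu') => [|a a' b b' aa bb]; last first.
  by apply: H => //; apply: bag_eq_refl.
by apply: eq_sum_splits => a b; apply: H; rewrite ?bag_eq_refl.
Qed.

End Generic.

(** * Derivatives of coherent terms *)

Lemma coh_bagP ts ts' : coh_bag ts ts' <->
  (forall t t', t \in ts ++ ts' -> t' \in ts ++ ts' -> coh t t').
Proof. by split=> [[]|]; last by constructor. Qed.

Lemma coh_bag_sub ts1 ts1' ts2 ts2' : coh_bag ts1 ts1' ->
  {subset ts2 <= ts1 ++ ts1'} -> {subset ts2' <= ts1 ++ ts1'} -> coh_bag ts2 ts2'.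
Proof.
move=> /coh_bagP ts1P sub sub'; apply/coh_bagP => t t'.
by rewrite !mem_cat => /orP tP /orP t'P; apply: ts1P; [case: tP|case: t'P]; auto.
Qed.

Lemma mem_splits us p : p \in splits us -> p.1 ++ p.2 =i us.
Proof. by move=> /perm_splits/perm_mem pE x; rewrite pE. Qed.

(** * Multiplicity of a monomial and number of its splittings *)

Definition bag_mult (cs : bag) : nat := mult_pairs [seq (c, mult c) | c <- cs].

Lemma mult_bag_canon ts : mult_bag ts = bag_mult (map canon ts).
Proof.
rewrite /mult_bag /bag_mult -map_comp; congr mult_pairs.
by apply: eq_map => t /=; rewrite mult_canon.
Qed.

Lemma mult_pairs_cons p ps :
  mult_pairs (p :: ps) = (count_mem p ps).+1 * p.2 * mult_pairs ps.
Proof.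
have count_ne q : q != p -> count_mem q (p :: ps) = count_mem q ps.
  by move=> qp; rewrite /= eq_sym (negbTE qp).
rewrite /mult_pairs [undup _]/=; case: ifP => pps.
  have pP : p \in undup ps by rewrite mem_undup.
  rewrite !(bigD1_seq p pP (undup_uniq _)).
  under [X in _ * X = _]eq_bigr => q qp do rewrite count_ne //.
  rewrite /= eqxx add1n factS expnS; ring.
rewrite big_cons (eq_big_seq (fun q => (count_mem q ps)`! * q.2 ^ count_mem q ps)).
  by rewrite /= eqxx (count_memPn _) ?pps //= add1n expn1 mul1n.
move=> q; rewrite mem_undup => qps; rewrite count_ne //.
by apply: contraFneq pps => <-.
Qed.

Lemma bag_mult_cons c cs : bag_mult (c :: cs) = (count_mem c cs).+1 * mult c * bag_mult cs.
Proof.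
rewrite /bag_mult map_cons mult_pairs_cons /=; congr (_.+1 * _ * _).
by rewrite count_map; apply: eq_count => x /=; apply/eqP/eqP => [[]|->].
Qed.

Lemma perm_bag_mult cs cs' : perm_eq cs cs' -> bag_mult cs = bag_mult cs'.
Proof. by move=> cc; apply/perm_mult_pairs/perm_map. Qed.

Lemma mult_bag_eq ts ts' : bag_eq ts ts' -> mult_bag ts = mult_bag ts'.
Proof. by move=> tt; rewrite !mult_bag_canon; apply: perm_bag_mult. Qed.

Lemma bag_mult_rem c cs : c \in cs ->
  bag_mult cs = count_mem c cs * mult c * bag_mult (rem c cs).
Proof.
move=> ccs; rewrite (perm_bag_mult (perm_to_rem ccs)) bag_mult_cons.
by rewrite (permP (perm_to_rem ccs)) /= eqxx.
Qed.

Definition count_splits (cs b1 b2 : bag) : nat :=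
  sum_splits cs (fun a b => perm_eq a b1 && perm_eq b b2).

Lemma perm_cons_rem (T : eqType) (x : T) s1 s2 :
  perm_eq (x :: s1) s2 = (x \in s2) && perm_eq s1 (rem x s2).
Proof.
have [xs2|xs2] := boolP (x \in s2) => /=.
  by rewrite (permPr (perm_to_rem xs2)) perm_cons.
by apply: contraNF xs2 => /perm_mem <-; rewrite mem_head.
Qed.

(** An element that occurs i times in [b1] and j times in [b2] can be distributed in binomial(i + j,
    i) ways, which is the quotient of the factorials in the multiplicities; the powers of the m(t)
    cancel. *)
Lemma count_splitsE cs b1 b2 : perm_eq cs (b1 ++ b2) ->
  count_splits cs b1 b2 * (bag_mult b1 * bag_mult b2) = bag_mult cs.
Proof.
have nilE : bag_mult [::] = 1 by rewrite /bag_mult /mult_pairs big_nil.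
elim: cs b1 b2 => [|c cs IH] b1 b2 cs12.
  move/perm_size: cs12; case: b1; case: b2 => // _.
  by rewrite /count_splits sum_splits_nil /= !nilE.
(* The splittings that send the first element [c] to the left. Those that send it to the right
   follow by symmetry, and the occurrences of [c] in [b1] and [b2] add up to those in [c :: cs]. *)
have half e1 e2 : perm_eq (c :: cs) (e1 ++ e2) ->
    sum_splits cs (fun a b => perm_eq (c :: a) e1 && perm_eq b e2)
      * (bag_mult e1 * bag_mult e2) = count_mem c e1 * (mult c * bag_mult cs).
  move=> cs_e; under eq_sum_splits => a b do rewrite perm_cons_rem -andbA.
  have [ce1|ce1] := boolP (c \in e1); last first.
    by rewrite sum_splits0 (count_memPn ce1).
  rewrite (bag_mult_rem ce1) -(IH (rem c e1) e2) /count_splits /=; first by ring.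
  rewrite -(perm_cons c) (permPl cs_e) -cat_cons perm_cat2r.
  exact: perm_to_rem.
rewrite /count_splits sum_splits_cons mulnDl half //.
rewrite sum_splitsC; under eq_sum_splits => a b do rewrite andbC.
rewrite [bag_mult b1 * _]mulnC half; last by rewrite perm_sym perm_catC perm_sym.
rewrite -mulnDl -count_cat -(permP cs12) bag_mult_cons /= eqxx add1n.
by rewrite mulnA.
Qed.

(** [A] and [B] are meant to be the coefficients of two parts of a reduct, of multiplicities [m1]
    and [m2], whose origins have multiplicities [n1] and [n2]. Only the splittings equal to
    [(b1, b2)] up to permutations contribute; they contribute equally, and [count_splitsE] counts
    them. *)
Lemma sum_splits_conv (A B : bag -> nat) us b1 b2 (m1 m2 n1 n2 : nat) :
  bag_eq us (b1 ++ b2) ->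
  (forall a b, (a, b) \in splits us -> A a != 0 -> B b != 0 ->
     bag_eq a b1 /\ bag_eq b b2) ->
  (forall a, {subset a <= us} -> bag_eq a b1 -> A a * m1 = n1 * mult_bag b1) ->
  (forall b, {subset b <= us} -> bag_eq b b2 -> B b * m2 = n2 * mult_bag b2) ->
  sum_splits us (fun a b => A a * B b) * (m1 * m2) = n1 * n2 * mult_bag us.
Proof.
move=> us12 AB Am Bm.
rewrite mult_bag_canon -(count_splitsE (b1 := map canon b1) (b2 := map canon b2)); last first.
  by rewrite -map_cat.
rewrite /count_splits sum_splits_map -!mult_bag_canon /sum_splits [RHS]mulnCA.
rewrite !big_distrl /=; apply: eq_big_seq => -[a b] abP /=.
have [eq_a|ne_a] /= := boolP (perm_eq (map canon a) (map canon b1)); last first.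
  rewrite mul0n; have [->|A0] := eqVneq (A a) 0; first by rewrite mul0n.
  have [->|B0] := eqVneq (B b) 0; first by rewrite muln0.
  by case: (AB a b abP A0 B0) ne_a; rewrite /bag_eq => ->.
have [eq_b|ne_b] /= := boolP (perm_eq (map canon b) (map canon b2)); last first.
  rewrite mul0n; have [->|A0] := eqVneq (A a) 0; first by rewrite mul0n.
  have [->|B0] := eqVneq (B b) 0; first by rewrite muln0.
  by case: (AB a b abP A0 B0) ne_b; rewrite /bag_eq => _ ->.
have sub := mem_splits abP.
have Aa : A a * m1 = n1 * mult_bag b1.
  by apply: Am eq_a => x xa; rewrite -sub mem_cat xa.
have Bb : B b * m2 = n2 * mult_bag b2.
  by apply: Bm eq_b => x xa; rewrite -sub mem_cat xa orbT.
by rewrite mulnACA Aa Bb; ring.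
Qed.

(** * Origin of the summands of a derivative *)

Section Uniform.

Variable d : rterm -> bag -> seq rterm.

(** Coherence of [t] and [t'] is what makes the origin unique: [y] is the derivative with respect to
    [x] both of [x] at [[y]] and of [y] at the empty monomial. *)
Definition coh_inj t t' : Prop := forall us us', coh_bag us us' ->
  forall r r', r \in d t us -> r' \in d t' us' ->
  coh r r' /\ (canon r = canon r' -> canon t = canon t' /\ bag_eq us us').

(** A triple of [z] records an element of [ts], its share of [us], and the summand chosen in its
    derivative, so that [ts], [us] and [r] can be permuted together. *)
Lemma diff_bag_witness ts us r : r \in diff_bag d ts us ->
  exists z : seq (rterm * bag * rterm),
    [/\ ts = map (fun x => x.1.1) z, r = map snd z,
        perm_eq us (flatten (map (fun x => x.1.2) z)) &
        forall x, x \in z -> x.2 \in d x.1.1 x.1.2].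
Proof.
elim: ts us r => [|t ts IH] us r.
  by case: us => //=; rewrite inE => /eqP->; exists [::].
case/flatten_mapP=> -[a b] abP /allpairsP[[t' r'] /= [t'P /IH[z [-> -> bz zP]] ->]].
exists ((t, a, t') :: z); split=> //=.
  by rewrite (perm_trans (perm_splits abP)) //= perm_cat2l.
by move=> x; rewrite inE => /predU1P[->|/zP].
Qed.

Lemma mem_splits_catlr a b : (a, b) \in splits (a ++ b).
Proof.
elim: a => [|u a IH] /=.
  elim: b => //= u b IH; rewrite mem_cat; apply/orP; right.
  by apply/mapP; exists ([::], b).
by rewrite mem_cat; apply/orP; left; apply/mapP; exists (a, b).
Qed.

Lemma mem_diff_bag_witness (z : seq (rterm * bag * rterm)) :
  (forall x, x \in z -> x.2 \in d x.1.1 x.1.2) ->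
  map snd z \in diff_bag d (map (fun x => x.1.1) z) (flatten (map (fun x => x.1.2) z)).
Proof.
elim: z => [|x z IH] zP //=.
rewrite -/(map snd z).
apply: (mem_diff_bag_cons (p := (_, _)) (mem_splits_catlr _ _)) => /=.
  exact: zP (mem_head _ _).
by apply: IH => y yz; apply: zP; rewrite inE yz orbT.
Qed.

Lemma perm_flatten_canon (z : seq (rterm * bag * rterm)) :
  perm_eq (map canon (flatten (map (fun x => x.1.2) z)))
    (flatten [seq canon_bag (map canon x.1.2) | x <- z]).
Proof.
elim: z => [|x z IH] //=; rewrite map_cat perm_cat //; exact: perm_canon_bag.
Qed.

(** Equal elements of [r] and [r'] have the same origin and the same share, so that a matching of
    [r] with [r'] is one of the triples behind them. Their projections then match the origins, and
    the shares taken together. *)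
Lemma diff_bag_coh ts ts' us us' r r' :
  (forall t t', t \in ts ++ ts' -> t' \in ts ++ ts' -> coh_inj t t') ->
  coh_bag us us' -> r \in diff_bag d ts us -> r' \in diff_bag d ts' us' ->
  coh_bag r r' /\ (bag_eq r r' -> bag_eq ts ts' /\ bag_eq us us').
Proof.
move=> dts uu' /diff_bag_witness[z [tsE rE usz zP]] /diff_bag_witness[z' [ts'E r'E us'z z'P]].
have mem_us x : x \in z ++ z' -> {subset x.1.2 <= us ++ us'}.
  rewrite mem_cat => /orP xz u ux; rewrite mem_cat (perm_mem usz) (perm_mem us'z).
  by case: xz => xz; apply/orP; [left|right]; apply/flattenP; exists x.1.2 => //;
    apply: (map_f (fun x => x.1.2)).
have mem_ts x : x \in z ++ z' -> x.1.1 \in ts ++ ts'.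
  rewrite tsE ts'E -map_cat; exact: (map_f (fun x => x.1.1)).
have coh_z x y : x \in z ++ z' -> y \in z ++ z' ->
    coh x.2 y.2 /\ (canon x.2 = canon y.2 -> canon x.1.1 = canon y.1.1 /\ bag_eq x.1.2 y.1.2).
  move=> xz yz; apply: dts (mem_ts x xz) (mem_ts y yz) _ _ _ _ _ _ _.
  - exact: coh_bag_sub uu' (mem_us x xz) (mem_us y yz).
  - by move: xz; rewrite mem_cat => /orP[/zP|/z'P].
  - by move: yz; rewrite mem_cat => /orP[/zP|/z'P].
split.
  apply/coh_bagP => t t'; rewrite rE r'E -map_cat => /mapP[x xz ->] /mapP[y yz ->].
  by case: (coh_z x y).
rewrite /bag_eq rE r'E -!map_comp => rr'.
have zz' : perm_eq [seq (canon x.1.1, canon_bag (map canon x.1.2)) | x <- z]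
    [seq (canon x.1.1, canon_bag (map canon x.1.2)) | x <- z'].
  apply: perm_map_factor rr' => x y xz yz /= xy.
  have [||_ /(_ xy) [-> /canon_bagP ->] //] := coh_z x y.
  - by rewrite mem_cat xz.
  - by rewrite mem_cat yz orbT.
split.
  rewrite tsE ts'E -!map_comp; have := perm_map fst zz'.
  by rewrite -!map_comp.
rewrite (perm_trans (perm_map _ usz)) // perm_sym (perm_trans (perm_map _ us'z)) // perm_sym.
rewrite (perm_trans (perm_flatten_canon z)) // perm_sym (perm_trans (perm_flatten_canon z')) //.
by have := perm_flatten (perm_map snd zz'); rewrite -!map_comp perm_sym.
Qed.

Lemma diff_app_coh s s' ts ts' us us' r r' :
  coh_inj s s' ->
  (forall t t', t \in ts ++ ts' -> t' \in ts ++ ts' -> coh_inj t t') ->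
  coh_bag us us' -> r \in diff_app d s ts us -> r' \in diff_app d s' ts' us' ->
  coh r r' /\ (canon r = canon r' -> canon (App s ts) = canon (App s' ts') /\ bag_eq us us').
Proof.
move=> ds dts uu' /flatten_mapP[p pP /allpairsP[[s1 r1] /= [s1P r1P ->]]].
move=> /flatten_mapP[p' p'P /allpairsP[[s2 r2] /= [s2P r2P ->]]].
have sub : coh_bag p.1 p'.1 /\ coh_bag p.2 p'.2.
  by split; apply: coh_bag_sub uu' _ _ => x xp;
    rewrite mem_cat -(mem_splits pP) -(mem_splits p'P) !mem_cat xp ?orbT.
have [coh_s inj_s] := ds _ _ sub.1 _ _ s1P s2P.
have [coh_r inj_r] := diff_bag_coh dts sub.2 r1P r2P.
split; first by constructor.
case=> /inj_s[-> pp1] /canon_bagP/inj_r[/canon_bagP -> pp2]; split=> //.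
rewrite (bag_eq_trans (perm_bag_eq (perm_splits pP))) // bag_eq_sym.
rewrite (bag_eq_trans (perm_bag_eq (perm_splits p'P))) // bag_eq_sym.
exact: bag_eq_cat.
Qed.

End Uniform.

(** * Coefficients of derivatives *)

Definition canon_count (T : seq rterm) (c : rterm) : nat :=
  \sum_(r <- T) (canon r == c).

Definition canon_count_bag (T : seq bag) (cs : bag) : nat :=
  \sum_(r <- T) perm_eq (map canon r) cs.

Lemma canon_count_neq0 T c : canon_count T c != 0 -> exists2 r, r \in T & canon r = c.
Proof.
move=> T0; have [/hasP[r rT /eqP rc]|/hasPn TN] := boolP (has (fun r => canon r == c) T).
  by exists r.
case/eqP: T0; rewrite /canon_count big_seq big1 // => r /TN /negbTE -> //.
Qed.

Lemma canon_count_bag_neq0 T cs : canon_count_bag T cs != 0 ->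
  exists2 r, r \in T & perm_eq (map canon r) cs.
Proof.
move=> T0; have [/hasP[r rT rc]|/hasPn TN] := boolP (has (fun r => perm_eq (map canon r) cs) T).
  by exists r.
case/eqP: T0; rewrite /canon_count_bag big_seq big1 // => r /TN /negbTE -> //.
Qed.

Lemma sum_mem_undup (T : eqType) (A cs : seq T) (h : T -> nat) :
  \sum_(x <- A) (x \in cs) * h x = \sum_(c <- undup cs) count_mem c A * h c.
Proof.
under [RHS]eq_bigr => c _ do rewrite -sum1_count big_mkcond big_distrl /=.
rewrite exchange_big /=; apply: eq_bigr => x _.
have [xcs|xcs] := boolP (x \in cs).
  rewrite (bigD1_seq x) ?mem_undup ?undup_uniq //= eqxx big1 ?addn0 // => c cx.
  by rewrite eq_sym (negbTE cx).
rewrite big1_seq // => c; rewrite mem_undup => /= ccs.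
by case: eqP => // xc; rewrite xc ccs in xcs.
Qed.

Section Multiplicity.

Variable d : rterm -> bag -> seq rterm.

Definition diff_mult t : Prop := forall us, coh_bag us us -> forall r, r \in d t us ->
  canon_count (d t us) (canon r) * mult r = mult t * mult_bag us.

(** The coefficient of an application is the convolution, over the splittings of [us], of the
    coefficients of its two components; [sum_splits_conv] evaluates it. *)
Lemma diff_app_mult s ts us r :
  coh_inj d s s -> diff_mult s ->
  (forall s', canon s = canon s' -> canon_inv d s s') ->
  (forall t t', t \in ts -> t' \in ts -> coh_inj d t t') ->
  (forall t, t \in ts -> forall t', canon t = canon t' -> canon_inv d t t') ->
  (forall us r, coh_bag us us -> r \in diff_bag d ts us ->
    canon_count_bag (diff_bag d ts us) (map canon r) * mult_bag r = mult_bag ts * mult_bag us) ->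
  coh_bag us us -> r \in diff_app d s ts us ->
  canon_count (diff_app d s ts us) (canon r) * mult r = mult (App s ts) * mult_bag us.
Proof.
move=> inj_s mult_s inv_s inj_ts inv_ts mult_ts uu.
case/flatten_mapP=> -[a0 b0] abP /allpairsP[[s1 r1] /= [s1P r1P ->]].
have subP a b : {subset a <= us} -> {subset b <= us} -> coh_bag a b.
  by move=> au bu; apply: coh_bag_sub uu _ _ => x; [move/au|move/bu]; rewrite mem_cat => ->.
have sub0 := mem_splits abP.
have a0u : {subset a0 <= us} by move=> x xa; rewrite -sub0 mem_cat xa.
have b0u : {subset b0 <= us} by move=> x xa; rewrite -sub0 mem_cat xa orbT.
rewrite /canon_count sum_diff_app.
have -> : sum_splits us (fun a b => \sum_(s' <- d s a) \sum_(r <- diff_bag d ts b)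
    (canon (App s' r) == canon (App s1 r1))) =
  sum_splits us (fun a b => canon_count (d s a) (canon s1) *
    canon_count_bag (diff_bag d ts b) (map canon r1)).
  apply: eq_sum_splits => a b; rewrite /canon_count big_distrl /=; apply: eq_bigr => s' _.
  rewrite /canon_count_bag big_distrr /=; apply: eq_bigr => r' _; rewrite mulnb.
  congr nat_of_bool; apply/eqP/andP=> [[-> /canon_bagP ->]|[/eqP-> /canon_bagP->]] //.
rewrite [mult _]/= -/(mult_bag r1) -/(mult_bag ts).
apply: (sum_splits_conv (b1 := a0) (b2 := b0)).
- exact/perm_bag_eq/(perm_splits abP).
- move=> a b /mem_splits sub /canon_count_neq0[s' s'P s's1] /canon_count_bag_neq0[r' r'P r'r1].
  have au : {subset a <= us} by move=> x xa; rewrite -sub mem_cat xa.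
  have bu : {subset b <= us} by move=> x xa; rewrite -sub mem_cat xa orbT.
  have [_ /(_ s's1) [_ ->]] := inj_s _ _ (subP _ _ au a0u) _ _ s'P s1P.
  have [|_ /(_ r'r1) [_ ->] //] := diff_bag_coh _ (subP _ _ bu b0u) r'P r1P.
  by move=> t t'; rewrite !mem_cat !orbb; apply: inj_ts.
- move=> a au aa0; rewrite -(mult_s _ (subP _ _ a0u a0u) _ s1P) /canon_count.
  by rewrite (inv_s _ erefl _ _ aa0 (fun c => c == canon s1)).
- move=> b bu bb0; rewrite -(mult_ts _ _ (subP _ _ b0u b0u) r1P) /canon_count_bag.
  rewrite (diff_bag_canon (F := fun r => perm_eq r (map canon r1)) inv_ts _ (bag_eq_refl ts) bb0) //.
  by move=> r' r'' rr; rewrite (permPl rr).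
Qed.

(* The canonical element c that t contributes to r determines the submonomial *)
(* consumed by t, and the possible values of c are the elements of r coming   *)
(* from copies of t: their number is the factor that t adds to m(ts).         *)
Lemma diff_bag_mult ts us r :
  (forall t, t \in ts -> diff_mult t) ->
  (forall t t', t \in ts -> t' \in ts -> coh_inj d t t') ->
  (forall t, t \in ts -> forall t', canon t = canon t' -> canon_inv d t t') ->
  coh_bag us us -> r \in diff_bag d ts us ->
  canon_count_bag (diff_bag d ts us) (map canon r) * mult_bag r = mult_bag ts * mult_bag us.
Proof.
(* Induction on the size, because the hypothesis is applied to a list that matches the tail only up
   to permutations. *)
elim: {ts}(size ts) {-2}ts (erefl (size ts)) us r => [|n IH] [|t ts] // => [_|[size_ts]] us r.
  move=> _ _ _ _; case: us => //=; rewrite inE => /eqP ->.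
  by rewrite /canon_count_bag big_seq1 /mult_bag /mult_pairs big_nil.
move=> mult_ts inj_ts inv_ts uu rP.
have [z [tsE rE usz zP]] := diff_bag_witness rP.
have mem_us x : x \in z -> {subset x.1.2 <= us}.
  move=> xz u ux; rewrite (perm_mem usz); apply/flattenP; exists x.1.2 => //.
  exact: (map_f (fun x => x.1.2)).
have mem_ts x : x \in z -> x.1.1 \in t :: ts.
  by rewrite tsE; apply: (map_f (fun x => x.1.1)).
have subP a b : {subset a <= us} -> {subset b <= us} -> coh_bag a b.
  by move=> au bu; apply: coh_bag_sub uu _ _ => x; [move/au|move/bu]; rewrite mem_cat => ->.
(* [K] is the right-hand side without the factor due to the copies of [t]; [D c] says that [c] comes
   from a copy of [t] in [z]; [N c] is the part of the coefficient in which the head [t] yields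
   [c]. *)
pose K := mult t * mult_bag ts * mult_bag us.
pose D c := has (fun x => (canon x.2 == c) && (canon x.1.1 == canon t)) z.
pose cs := map canon r.
pose N c := sum_splits us (fun a b => canon_count (d t a) c *
    canon_count_bag (diff_bag d ts b) (rem c cs)).
have sumD (A : seq rterm) (h : rterm -> nat) :
    \sum_(x <- A) (x \in cs) * h x = \sum_(c <- undup cs) count_mem c A * h c.
  exact: sum_mem_undup.
have NE : canon_count_bag (diff_bag d (t :: ts) us) cs = \sum_(c <- undup cs) N c.
  rewrite /N -sum_splits_sum /canon_count_bag sum_diff_bag_cons.
  apply: eq_sum_splits => a b.
  transitivity (\sum_(x <- map canon (d t a))
      (x \in cs) * canon_count_bag (diff_bag d ts b) (rem x cs)).
    rewrite big_map; apply: eq_bigr => x _; rewrite /canon_count_bag big_distrr /=.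
    by apply: eq_bigr => r' _; rewrite perm_cons_rem mulnb.
  rewrite sumD; apply: eq_bigr => c _; congr (_ * _).
  by rewrite /canon_count -sum1_count big_map [LHS]big_mkcond.
have ND c : c \in cs -> N c * bag_mult cs = D c * count_mem c cs * K.
  move=> ccs; rewrite (bag_mult_rem ccs); have [|DN] := boolP (D c); last first.
    suff -> : N c = 0 by [].
    apply: big1_seq => -[a b] /= /mem_splits sub; apply/eqP; rewrite muln_eq0.
    apply: contraNT DN => /norP[/canon_count_neq0[x' x'P x'c] _].
    have au : {subset a <= us} by move=> x xa; rewrite -sub mem_cat xa.
    move: ccs; rewrite /cs rE -map_comp => /mapP[x xz /= cx]; apply/hasP; exists x => //.
    have [_] := inj_ts _ _ (mem_head _ _) (mem_ts x xz) _ _ (subP _ _ au (mem_us x xz)) _ _ x'P (zP x xz).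
    by rewrite x'c cx => /(_ erefl) [-> _]; rewrite !eqxx.
  (* [x0] is a copy of [t] that yields [c]. Without it, [z'] witnesses a summand of the derivative
     of the remaining elements, to which the induction hypothesis applies. *)
  case/hasP=> x0 x0z /andP[/eqP x0c /eqP x0t].
  have z0 := perm_to_rem x0z; set z' := rem x0 z in z0.
  pose u0 := x0.1.2; pose b2 := flatten (map (fun x => x.1.2) z').
  pose ts' := map (fun x => x.1.1) z'; pose r' := map snd z'.
  have z'z : {subset z' <= z} by exact: mem_rem.
  have us_eq : perm_eq us (u0 ++ b2).
    rewrite (perm_trans usz) //.
    by have := perm_flatten (perm_map (fun x => x.1.2) z0).
  have ts'ts : bag_eq ts ts'.
    rewrite -(bag_eq_cons (u := t) (u' := x0.1.1)) //.
    rewrite /bag_eq tsE perm_map //.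
    exact: (perm_map (fun x => x.1.1) z0).
  have r'cs : perm_eq (map canon r') (rem c cs).
    rewrite -(perm_cons c) -[c in perm_eq (c :: _)]x0c perm_sym.
    rewrite perm_sym -(permPr (perm_to_rem ccs)) /cs rE.
    by rewrite perm_sym -[_ :: _]/(map canon (map snd (x0 :: z'))); do 2!apply: perm_map.
  have u0u : {subset u0 <= us} := mem_us x0 x0z.
  have b2u : {subset b2 <= us} by move=> x xb; rewrite (perm_mem us_eq) mem_cat xb orbT.
  have NK : N c * (mult c * bag_mult (rem c cs)) = K.
    apply: (sum_splits_conv (b1 := u0) (b2 := b2)); first exact: perm_bag_eq.
    - move=> a b abP /canon_count_neq0[x' x'P x'c] _.
      have au : {subset a <= us} by move=> x xa; rewrite -(mem_splits abP) mem_cat xa.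
      have [_] := inj_ts _ _ (mem_head _ _) (mem_ts x0 x0z) _ _ (subP _ _ au u0u) _ _ x'P (zP x0 x0z).
      rewrite x'c x0c => /(_ erefl) [_ au0]; split=> //.
      apply: (bag_eq_catl au0); apply: (@bag_eq_trans _ us); last exact: perm_bag_eq.
      by rewrite bag_eq_sym; apply: perm_bag_eq (perm_splits abP).
    - move=> a au au0; rewrite -(mult_canon t) -x0t mult_canon.
      rewrite -(mult_ts _ (mem_ts _ x0z) _ (subP _ _ u0u u0u) _ (zP _ x0z)) x0c -x0c mult_canon.
      by rewrite /canon_count (inv_ts _ (mem_head _ _) _ (esym x0t) _ _ au0 (fun c => c == canon x0.2)).
    - move=> b bu bb2; rewrite (mult_bag_eq ts'ts).
      have ts'P x : x \in ts' -> x \in t :: ts.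
        by move=> /mapP[y /z'z yz ->]; apply: mem_ts.
      have r'P : r' \in diff_bag d ts' b2.
        by apply: mem_diff_bag_witness => x /z'z; apply: zP.
      rewrite -(IH ts' _ _ _ _ _ _ (subP _ _ b2u b2u) r'P).
      + rewrite mult_bag_canon (perm_bag_mult r'cs); congr (_ * _).
        rewrite /canon_count_bag.
        rewrite (diff_bag_canon (F := fun r => perm_eq r (rem c cs)) _ _ ts'ts bb2).
        * by apply: eq_bigr => x _; rewrite (permPr r'cs).
        * by move=> t' t'P; apply: inv_ts; rewrite inE t'P orbT.
        * by move=> r1 r2 rr; rewrite (permPl rr).
      + by have := perm_size ts'ts; rewrite !size_map => <-.
      + by move=> t' /ts'P; apply: mult_ts.
      + by move=> t1 t2 /ts'P t1P /ts'P t2P; apply: inj_ts.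
      + by move=> t1 /ts'P t1P; apply: inv_ts.
  rewrite mul1n -NK; ring.
rewrite mult_bag_canon NE big_distrl /= (eq_big_seq (fun c => D c * count_mem c cs * K)); last first.
  by move=> c; rewrite mem_undup => /ND.
rewrite -big_distrl /= [mult_bag (t :: ts)]mult_bag_canon map_cons bag_mult_cons mult_canon.
rewrite -mult_bag_canon.
(* The elements of [r] that satisfy [D] are exactly those whose origin is a copy of [t], by
   injectivity, and each copy of [t] in [t :: ts] yields one of them. *)
suff -> : \sum_(c <- undup cs) D c * count_mem c cs = (count_mem (canon t) (map canon ts)).+1.
  by rewrite /K; ring.
have -> : \sum_(c <- undup cs) D c * count_mem c cs = count D cs.
  under eq_bigr => c _ do rewrite mulnC.
  rewrite -sum_mem_undup -sum1_count [RHS]big_mkcond big_seq [RHS]big_seq.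
  by apply: eq_bigr => c ->; rewrite mul1n; case: (D c).
transitivity (count_mem (canon t) (map canon (t :: ts))); last by rewrite /= eqxx.
rewrite /cs rE tsE -!map_comp !count_map; apply: eq_in_count => x xz /=.
apply/hasP/eqP => [[y yz /andP[/eqP yx /eqP <-]]|xt]; last by exists x; rewrite ?xt ?eqxx.
have [_ /(_ yx) []] := inj_ts _ _ (mem_ts y yz) (mem_ts x xz) _ _
  (subP _ _ (mem_us y yz) (mem_us x xz)) _ _ (zP y yz) (zP x xz).
by [].
Qed.

End Multiplicity.

(* Coherence and multiplicity for the derivatives of terms *)
Scheme coh_mut := Minimality for coh Sort Prop
with coh_bag_mut := Minimality for coh_bag Sort Prop.

Lemma coh_ind_in (P : rterm -> rterm -> Prop) :
  (forall x, P (Var x) (Var x)) ->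
  (forall s s', coh s s' -> P s s' -> P (Lam s) (Lam s')) ->
  (forall s s' ts ts', coh s s' -> P s s' ->
    (forall t t', t \in ts ++ ts' -> t' \in ts ++ ts' -> coh t t' /\ P t t') ->
    P (App s ts) (App s' ts')) ->
  (forall s s', coh s s' -> P s s' -> P (Inl s) (Inl s')) ->
  (forall s s', coh s s' -> P s s' -> P (Inr s) (Inr s')) ->
  (forall s s', P (Inl s) (Inr s')) ->
  (forall s s', P (Inr s) (Inl s')) ->
  forall t t', coh t t' -> P t t'.
Proof.
move=> PVar PLam PApp PInl PInr PInlInr PInrInl.
apply: (@coh_mut P (fun ts ts' =>
  forall t t', t \in ts ++ ts' -> t' \in ts ++ ts' -> coh t t' /\ P t t')) => //.
- by move=> s s' ts ts' ss Ps _ Pts; apply: PApp.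
- by move=> ts ts' tts Pts t t' tP t'P; split; auto.
Qed.

Lemma coh_lift k t t' : coh t t' -> coh (lift k t) (lift k t').
Proof.
move=> tt'; elim/coh_ind_in: t t' / tt' k => /=; try by [constructor|move=> *; constructor].
move=> s s' ts ts' _ IHs IHts k; constructor=> //; apply/coh_bagP => u u'.
by rewrite -map_cat => /mapP[t tP ->] /mapP[t' t'P ->]; apply: (IHts t t' tP t'P).2.
Qed.

Lemma coh_bag_lift k ts ts' : coh_bag ts ts' -> coh_bag (map (lift k) ts) (map (lift k) ts').
Proof.
move=> /coh_bagP tts; apply/coh_bagP => u u'.
by rewrite -map_cat => /mapP[t tP ->] /mapP[t' t'P ->]; apply/coh_lift/tts.
Qed.

Lemma coh_LamP s s' : coh (Lam s) (Lam s') -> coh s s'.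
Proof. by move=> H; inversion H. Qed.

Lemma coh_InlP s s' : coh (Inl s) (Inl s') -> coh s s'.
Proof. by move=> H; inversion H. Qed.

Lemma coh_InrP s s' : coh (Inr s) (Inr s') -> coh s s'.
Proof. by move=> H; inversion H. Qed.

Lemma coh_AppP s s' ts ts' : coh (App s ts) (App s' ts') -> coh s s' /\ coh_bag ts ts'.
Proof. by move=> H; inversion H. Qed.

Lemma mult_lift k t : mult (lift k t) = mult t.
Proof.
elim/rterm_ind_in: t k => //= s ts IHs IHts k; rewrite IHs -!/(mult_bag _); congr (_ * _).
elim: ts IHts => //= t ts IH IHts.
rewrite !mult_bag_canon /= !bag_mult_cons -!mult_bag_canon !mult_canon.
rewrite (IHts t) ?mem_head // IH => [|u uts]; last by apply: IHts; rewrite inE uts orbT.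
congr (_.+1 * _ * _); rewrite !count_map; apply: eq_count => u /=.
by apply/eqP/eqP; rewrite canon_liftP.
Qed.

Lemma mult_bag_lift k ts : mult_bag (map (lift k) ts) = mult_bag ts.
Proof. by have := mult_lift k (App (Var 0) ts); rewrite /= !mul1n. Qed.

Lemma diff_canon t k t' : canon t = canon t' -> canon_inv (diff k) t t'.
Proof.
elim/rterm_ind_in: t k t' => [x|s IH|s ts IHs IHts|s IH|s IH] k
  [y|s'|s' ts'|s'|s'] //= tt' us us' uu' f.
- case: tt' => <-; have := perm_size uu'; rewrite !size_map.
  case: us uu' => [|u [|v us]]; case: us' => [|u' [|v' us']] //= uu' _;
    case: (x == k) => //; rewrite ?big_nil // !big_seq1.
  by rewrite /bag_eq /= in uu'; move/perm_mem: uu' => /(_ (canon u)); rewrite !inE eqxx => /esym/eqP ->.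
- case: tt' => ss'; rewrite !big_map /=.
  by apply: (IH k.+1 s' ss' _ _ _ (f \o Lam)); rewrite bag_eq_lift.
- case: tt' => ss' /canon_bagP tts'; rewrite !diff_App.
  apply: diff_app_canon => // [s2|t tts t2]; [exact: IHs|exact: IHts].
- by case: tt' => ss'; rewrite !big_map /=; apply: (IH k s' ss' _ _ _ (f \o Inl)).
- by case: tt' => ss'; rewrite !big_map /=; apply: (IH k s' ss' _ _ _ (f \o Inr)).
Qed.

Lemma diff_coh t t' : coh t t' -> forall k, coh_inj (diff k) t t'.
Proof.
move=> tt'; elim/coh_ind_in: t t' / tt' =>
  [x|s s' _ IH|s s' ts ts' _ IHs IHts|s s' _ IH|s s' _ IH|s s'|s s'] k us us' uu' r r'.
- rewrite /=; case: (x == k); last first.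
    by case: us uu' => [|//] _; case: us' => [|//]; rewrite !inE => /eqP-> /eqP->; split=> //; constructor.
  case: us uu' => [|u [|//]]; case: us' => [|u' [|//]] // /coh_bagP uu'.
  rewrite !inE => /eqP-> /eqP->; split; first by apply: uu'; rewrite !inE eqxx ?orbT.
  by move=> uE; split=> //; rewrite bag_eq_cons.
- move=> /mapP[r1 r1P ->] /mapP[r2 r2P ->].
  have [c i] := IH k.+1 _ _ (coh_bag_lift 0 uu') _ _ r1P r2P; split; first by constructor.
  by case=> /i[/= ->]; rewrite bag_eq_lift.
- rewrite !diff_App; apply: diff_app_coh uu' => // t t' tP t'P.
  exact: (IHts t t' tP t'P).2.
- move=> /mapP[r1 r1P ->] /mapP[r2 r2P ->].
  have [c i] := IH k _ _ uu' _ _ r1P r2P; split; first by constructor.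
  by case=> /i[/= ->].
- move=> /mapP[r1 r1P ->] /mapP[r2 r2P ->].
  have [c i] := IH k _ _ uu' _ _ r1P r2P; split; first by constructor.
  by case=> /i[/= ->].
- by move=> /mapP[r1 r1P ->] /mapP[r2 r2P ->]; split; first by constructor.
- by move=> /mapP[r1 r1P ->] /mapP[r2 r2P ->]; split; first by constructor.
Qed.

Lemma canon_count_map (f h : rterm -> rterm) T c :
  injective h -> (forall r, canon (f r) = h (canon r)) ->
  canon_count (map f T) (h c) = canon_count T c.
Proof.
move=> h_inj fh; rewrite /canon_count big_map; apply: eq_bigr => r _.
by rewrite fh (inj_eq h_inj).
Qed.

Lemma diff_multE t : coh t t -> forall k, diff_mult (diff k) t.
Proof.
elim/rterm_ind_in: t => [x|s IH|s ts IHs IHts|s IH|s IH] tt k us uu r.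
- have m1 u : mult_bag [:: u] = mult u.
    by rewrite /mult_bag mult_pairs_cons /mult_pairs big_nil /= mul1n muln1.
  rewrite /=; case: (x == k).
    case: us uu => [|u [|//]] // _; rewrite inE => /eqP->.
    by rewrite /canon_count big_seq1 eqxx m1.
  by case: us uu => [|//] _; rewrite inE => /eqP->;
    rewrite /canon_count big_seq1 eqxx /mult_bag /mult_pairs big_nil.
- move=> /mapP[r1 r1P ->]; rewrite (canon_count_map (h := Lam)) // => [|a b [] //].
  by rewrite /= IH ?mult_bag_lift //; [exact: coh_LamP|exact: coh_bag_lift].
- have [ss /coh_bagP tts] := coh_AppP tt.
  have tts' t t' : t \in ts -> t' \in ts -> coh t t'.
    by move=> tP t'P; apply: tts; rewrite mem_cat ?tP ?t'P.
  rewrite diff_App; apply: diff_app_mult => //.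
  + exact: diff_coh.
  + exact: IHs.
  + by move=> s'; apply: diff_canon.
  + by move=> t t' tP t'P; apply/diff_coh/tts'.
  + by move=> t _ t'; apply: diff_canon.
  move=> us' r' uu' r'P; apply: diff_bag_mult => //.
  + by move=> t tP; apply: IHts => //; apply: tts'.
  + by move=> t t' tP t'P; apply/diff_coh/tts'.
  + by move=> t _ t'; apply: diff_canon.
- move=> /mapP[r1 r1P ->]; rewrite (canon_count_map (h := Inl)) // => [|a b [] //].
  by rewrite /= IH //; exact: coh_InlP.
- move=> /mapP[r1 r1P ->]; rewrite (canon_count_map (h := Inr)) // => [|a b [] //].
  by rewrite /= IH //; exact: coh_InrP.
Qed.

(** * Parallel reduction *)

(* A parallel reduction that fires the same redex in all the coherent copies. *)
Fixpoint head_red (t : rterm) : seq rterm :=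
  match t with
  | Var x => [:: Var x]
  | Lam s =>
      match s with
      | Inl u => [:: Inl (Lam u)]
      | Inr u => [:: Inr (Lam u)]
      | _ => map Lam (head_red s)
      end
  | App s ts =>
      match head_step s ts with
      | Some T => T
      | None => diff_app (fun t us => if us is [::] then head_red t else [::]) s ts [::]
      end
  | Inl s => map Inl (head_red s)
  | Inr s => map Inr (head_red s)
  end.

(** Parallel reduction in the guise of a derivative at the empty monomial, to which the results on
    [diff_bag] and [diff_app] for an abstract [d] apply. *)
Definition head_red_nil (t : rterm) (us : bag) : seq rterm :=
  if us is [::] then head_red t else [::].

Variant head_red_Lam_spec (s : rterm) : seq rterm -> Prop :=
| HeadRedLamInl u of s = Inl u : head_red_Lam_spec s [:: Inl (Lam u)]
| HeadRedLamInr u of s = Inr u : head_red_Lam_spec s [:: Inr (Lam u)]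
| HeadRedLam of (forall u, s <> Inl u) & (forall u, s <> Inr u) :
    head_red_Lam_spec s (map Lam (head_red s)).

Lemma head_red_LamP s : head_red_Lam_spec s (head_red (Lam s)).
Proof. by case: s => *; econstructor. Qed.

Variant head_red_App_spec (s : rterm) (ts : bag) : seq rterm -> Prop :=
| HeadRedAppStep T of head_step s ts = Some T : head_red_App_spec s ts T
| HeadRedApp of head_step s ts = None :
   head_red_App_spec s ts (diff_app head_red_nil s ts [::]).

Lemma head_red_AppP s ts : head_red_App_spec s ts (head_red (App s ts)).
Proof. by rewrite /=; case E: head_step => [T|]; constructor. Qed.

Lemma head_step_step s ts T : head_step s ts = Some T -> step (App s ts) T.
Proof. by case: s => //= s [<-]; constructor. Qed.

(** A parallel reduction consists of steps in disjoint subterms; the induction composes [g] with the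
    context of each subterm. *)
Lemma sum_head_red g t : (forall r, step_inv g r) -> \sum_(r <- head_red t) g r = g t.
Proof.
elim/rterm_ind_in: t g => [x|s IH|s ts IHs IHts|s IH|s IH] g gP.
- by rewrite /= big_seq1.
- case: head_red_LamP => [u ->|u ->|_ _].
  + by rewrite (gP _ _ (step_Lam_Inl u)).
  + by rewrite (gP _ _ (step_Lam_Inr u)).
  + by rewrite big_map (IH (g \o Lam)) // => r; apply: step_inv_Lam.
- case: head_red_AppP => [T /head_step_step/gP -> //|_].
  rewrite sum_diff_app sum_splits_nil exchange_big /=.
  have db G : (forall r, step_bag_inv G r) ->
      \sum_(r <- diff_bag head_red_nil ts [::]) G r = G ts.
    elim: ts IHts G => [|t ts IH] IHts G GP; first by rewrite sum_diff_bag_nil.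
    rewrite sum_diff_bag_cons sum_splits_nil exchange_big /=.
    rewrite (IH _ (fun r => \sum_(t' <- head_red t) G (t' :: r))).
    + rewrite (IHts t (mem_head _ _) (fun t' => G (t' :: ts))) // => r.
      exact: step_bag_inv_head.
    + by move=> u uts; apply: IHts; rewrite inE uts orbT.
    + move=> r T rT; rewrite [RHS]exchange_big /=; apply: eq_bigr => t' _.
      by rewrite (step_bag_inv_behead (GP (t' :: r)) rT).
  rewrite (db (fun r => \sum_(s' <- head_red s) g (App s' r))) => [|r T rT].
    by rewrite (IHs (g \o App^~ ts)) // => r; apply: step_inv_App_l.
  rewrite [RHS]exchange_big /=; apply: eq_bigr => s' _.
  exact: (step_inv_App_r (gP (App s' r)) rT).
- by rewrite /= big_map (IH (g \o Inl)) // => r; apply: step_inv_Inl.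
- by rewrite /= big_map (IH (g \o Inr)) // => r; apply: step_inv_Inr.
Qed.

Lemma diff_bag_head_red t ts : diff_bag head_red_nil (t :: ts) [::] =
  [seq t' :: r | t' <- head_red t, r <- diff_bag head_red_nil ts [::]].
Proof. exact: cats0. Qed.

Lemma diff_app_head_red s ts : diff_app head_red_nil s ts [::] =
  [seq App s' r | s' <- head_red s, r <- diff_bag head_red_nil ts [::]].
Proof. exact: cats0. Qed.

(** Allows inductions on [meas] along [head_red], whose base case consists of normal terms. *)
Lemma head_red_decr t : (head_red t = [:: t] /\ forall T, ~ step t T) \/
  (forall r, r \in head_red t -> decr (meas r) (meas t)).
Proof.
elim/rterm_ind_in: t => [x|s IH|s ts IHs IHts|s IH|s IH].
- by left; split=> // T /step_VarP.
- case: head_red_LamP => [u ->|u ->|sN1 sN2].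
  + by right=> r; apply: step_decr.1 (step_Lam_Inl u) r.
  + by right=> r; apply: step_decr.1 (step_Lam_Inr u) r.
  case: IH => [[-> sN]|sD]; [left|right].
    by split=> // T /step_LamP[[u /sN1] //|[u /sN2] //|[S /sN]].
  by move=> r /mapP[s' /sD + ->]; rewrite /decr /=; lia.
- case: head_red_AppP => [T /head_step_step tT|hN].
    by right=> r; apply: step_decr.1 tT r.
  have db : (diff_bag head_red_nil ts [::] = [:: ts] /\ forall T, ~ step_bag ts T) \/
     (forall r, r \in diff_bag head_red_nil ts [::] -> decr (meas_bag r) (meas_bag ts)).
    elim: ts {hN} IHts => [|t ts IH] IHts; first by left; split=> // T /step_bag_nilP.
    have {}IH := IH (fun u uts => IHts u (@mem_behead _ (t :: ts) u uts)).
    have [[tE tN]|tD] := IHts t (mem_head _ _); have [[tsE tsN]|tsD] := IH.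
    + left; rewrite diff_bag_head_red tE tsE; split=> // T.
      by move=> /step_bag_consP[[T1 /tN]|[T1 /tsN]].
    + right=> r; rewrite diff_bag_head_red => /allpairsP[[t' r'] /= []].
      by rewrite tE inE => /eqP-> /tsD + ->; rewrite /decr /=; lia.
    + right=> r; rewrite diff_bag_head_red => /allpairsP[[t' r'] /= []].
      by rewrite tsE inE => /tD + /eqP-> ->; rewrite /decr /=; lia.
    + right=> r; rewrite diff_bag_head_red => /allpairsP[[t' r'] /= []].
      by move=> /tD + /tsD + ->; rewrite /decr /=; lia.
  case: IHs db => [[sE sN]|sD] [[tsE tsN]|tsD].
  + left; rewrite diff_app_head_red sE tsE; split=> // T.
    by case/step_AppP=> [|[S /sN]|[S /tsN]] //; rewrite hN.
  + right=> r; rewrite diff_app_head_red => /allpairsP[[t' r'] /= []].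
    by rewrite sE inE => /eqP-> /tsD + ->; rewrite /decr /=; lia.
  + right=> r; rewrite diff_app_head_red => /allpairsP[[t' r'] /= []].
    by rewrite tsE inE => /sD + /eqP-> ->; rewrite /decr /=; lia.
  + right=> r; rewrite diff_app_head_red => /allpairsP[[t' r'] /= []].
    by move=> /sD + /tsD + ->; rewrite /decr /=; lia.
- case: IH => [[/= -> sN]|sD]; [left|right].
    by split=> // T /step_InlP[S /sN].
  by move=> r /mapP[s' /sD + ->]; rewrite /decr /=; lia.
- case: IH => [[/= -> sN]|sD]; [left|right].
    by split=> // T /step_InrP[S /sN].
  by move=> r /mapP[s' /sD + ->]; rewrite /decr /=; lia.
Qed.

Lemma canon_head_step s s' ts ts' : canon s = canon s' ->
  (head_step s ts == None) = (head_step s' ts' == None).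
Proof. by case: s; case: s'. Qed.

Lemma head_red_nil_canon t t' :
  (forall f : rterm -> nat,
     \sum_(r <- head_red t) f (canon r) = \sum_(r <- head_red t') f (canon r)) ->
  canon_inv head_red_nil t t'.
Proof.
move=> tt' us us' /perm_size; rewrite !size_map => uu' f.
by case: us us' uu' => [|u us] [|u' us'] //= _; rewrite !big_nil.
Qed.

Lemma head_red_canon t t' (f : rterm -> nat) : canon t = canon t' ->
  \sum_(r <- head_red t) f (canon r) = \sum_(r <- head_red t') f (canon r).
Proof.
elim/rterm_ind_in: t t' f => [x|s IH|s ts IHs IHts|s IH|s IH] [y|s'|s' ts'|s'|s'] f //.
- by move=> [->].
- move=> /= -[ss']; case: s s' ss' IH => [x|s|s ts|s|s] [y|s'|s' ts'|s'|s'] //= ss' IH;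
    rewrite ?big_seq1 /= ?ss' //; try by case: ss' => ->.
  + by rewrite !big_map; apply: (IH (Lam s') (f \o Lam)).
  + by rewrite !big_map; apply: (IH (App s' ts') (f \o Lam)).
- move=> tt'; have [ss' tts'] := (canon_AppP s ts s' ts').1 tt'.
  case: head_red_AppP => [T hT|hN]; last first.
    case: head_red_AppP => [T hT|hN'].
      by have := canon_head_step ts ts' ss'; rewrite hN hT.
    apply: diff_app_canon => // [s2 ss2|t tts t2 tt2].
      by apply: head_red_nil_canon => g; apply: IHs.
    by apply: head_red_nil_canon => g; apply: IHts.
  case: (head_red_AppP s' ts') => [T' hT'|hN']; last first.
    by have := canon_head_step ts ts' ss'; rewrite hT hN'.
  case: s ss' hT {tt' IHs} => //= u; case: s' hT' => //= u' [<-] [uu'] [<-].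
  + exact: diff_canon.
  + by rewrite !big_seq1 /= uu' (canon_bagP _ _ tts').
  + by rewrite !big_seq1 /= uu' (canon_bagP _ _ tts').
- by move=> [ss'] /=; rewrite !big_map; apply: (IH s' (f \o Inl)).
- by move=> [ss'] /=; rewrite !big_map; apply: (IH s' (f \o Inr)).
Qed.

Definition head_red_coh_inj t t' : Prop :=
  forall r r', r \in head_red t -> r' \in head_red t' ->
  coh r r' /\ (canon r = canon r' -> canon t = canon t').

Lemma head_red_nil_coh t t' : head_red_coh_inj t t' -> coh_inj head_red_nil t t'.
Proof.
move=> tt' [|u us] [|u' us'] _ r r' // rP r'P.
by have [c i] := tt' r r' rP r'P; split=> // /i.
Qed.

Lemma coh_bag_nil : coh_bag [::] [::].
Proof. by constructor. Qed.

(** Coherent terms fire the same rules at the same places, except where one has [Inl] and the other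
    [Inr]; the reducts there still begin with opposite sides, hence are coherent and distinct. *)
Lemma head_red_coh t t' : coh t t' -> head_red_coh_inj t t'.
Proof.
move=> tt'; elim/coh_ind_in: t t' / tt' =>
  [x|s s' ss' IH|s s' ts ts' ss' IHs IHts|s s' _ IH|s s' _ IH|s s'|s s'] r r'.
- by rewrite /= !inE => /eqP-> /eqP->; split=> //; constructor.
- case: head_red_LamP => [u sE|u sE|s1 s2]; case: head_red_LamP => [u' s'E|u' s'E|s'1 s'2].
  + move: ss'; rewrite sE s'E => /coh_InlP uu'; rewrite !inE => /eqP-> /eqP->.
    by split=> [|[/= ->] //]; do 2!constructor.
  + by rewrite sE s'E !inE => /eqP-> /eqP->; split=> //; constructor.
  + by case: ss' sE s'1 s'2 => // [a b _ [->] /(_ b)|a b [->] _ /(_ b)].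
  + by rewrite sE s'E !inE => /eqP-> /eqP->; split=> //; constructor.
  + move: ss'; rewrite sE s'E => /coh_InrP uu'; rewrite !inE => /eqP-> /eqP->.
    by split=> [|[/= ->] //]; do 2!constructor.
  + by case: ss' sE s'1 s'2 => // [a b _ [->] _ /(_ b)|a b [->] /(_ b)].
  + by case: ss' s'E s1 s2 => // [a b _ [->] /(_ a)|a b [->] _ /(_ a)].
  + by case: ss' s'E s1 s2 => // [a b _ [->] _ /(_ a)|a b [->] /(_ a)].
  + move=> /mapP[r1 r1P ->] /mapP[r2 r2P ->].
    have [c i] := IH _ _ r1P r2P; split; first by constructor.
    by case=> /i /= ->.
- have tts : coh_bag ts ts'.
    by apply/coh_bagP => t t' tP t'P; apply: (IHts t t' tP t'P).1.
  case: head_red_AppP => [T hT|hN]; case: head_red_AppP => [T' hT'|hN'].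
  + case: ss' IHs hT hT' => //= u u'.
    * move=> uu' _ [<-] [<-] rP r'P.
      have [c i] := @diff_coh _ _ uu' 0 _ _ tts _ _ rP r'P; split=> // /i[-> /canon_bagP ->] //.
    * move=> uu' _ [<-] [<-]; rewrite !inE => /eqP-> /eqP->.
      by split=> [|[/= -> ->] //]; do 2!constructor.
    * move=> uu' _ [<-] [<-]; rewrite !inE => /eqP-> /eqP->.
      by split=> [|[/= -> ->] //]; do 2!constructor.
    * by move=> _ [<-] [<-]; rewrite !inE => /eqP-> /eqP->; split=> //; constructor.
    * by move=> _ [<-] [<-]; rewrite !inE => /eqP-> /eqP->; split=> //; constructor.
  + by case: ss' hT hN'.
  + by case: ss' hN hT'.
  + move=> rP r'P.
    have [||c i] := diff_app_coh _ _ coh_bag_nil rP r'P.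
    * exact: head_red_nil_coh.
    * by move=> t t' tP t'P; apply: head_red_nil_coh; apply: (IHts t t' tP t'P).2.
    * by split=> // /i[].
- move=> /mapP[r1 r1P ->] /mapP[r2 r2P ->].
  have [c i] := IH _ _ r1P r2P; split; first by constructor.
  by case=> /i /= ->.
- move=> /mapP[r1 r1P ->] /mapP[r2 r2P ->].
  have [c i] := IH _ _ r1P r2P; split; first by constructor.
  by case=> /i /= ->.
- by move=> /mapP[r1 r1P ->] /mapP[r2 r2P ->]; split; first by constructor.
- by move=> /mapP[r1 r1P ->] /mapP[r2 r2P ->]; split; first by constructor.
Qed.

Lemma mult_bag_nil : mult_bag [::] = 1.
Proof. by rewrite /mult_bag /mult_pairs big_nil. Qed.

(** A beta-redex is covered by [diff_multE], and an application without a redex at its root by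
    [diff_app_mult] at the empty monomial, of multiplicity 1. *)
Lemma head_red_mult t r : coh t t -> r \in head_red t ->
  canon_count (head_red t) (canon r) * mult r = mult t.
Proof.
elim/rterm_ind_in: t r => [x|s IH|s ts IHs IHts|s IH|s IH] r tt.
- by rewrite inE => /eqP->; rewrite /canon_count big_seq1 eqxx.
- case: head_red_LamP => [u ->|u ->|_ _]; try by
    rewrite inE => /eqP->; rewrite /canon_count big_seq1 eqxx mul1n.
  move=> /mapP[r1 r1P ->]; rewrite (canon_count_map (h := Lam)) // => [|a b [] //].
  by rewrite /= IH //; exact: coh_LamP.
- have [ss tts] := coh_AppP tt.
  case: head_red_AppP => [T hT|hN].
    case: s ss hT {IHs tt} => //= u uu [<-].
    + by move=> rP; rewrite (diff_multE (coh_LamP uu) tts rP).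
    + by rewrite inE => /eqP->; rewrite /canon_count big_seq1 eqxx mul1n.
    + by rewrite inE => /eqP->; rewrite /canon_count big_seq1 eqxx mul1n.
  have tts' t t' : t \in ts -> t' \in ts -> coh t t'.
    by move: tts => /coh_bagP tts tP t'P; apply: tts; rewrite mem_cat ?tP ?t'P.
  have nil_mult t : coh t t -> (forall r, r \in head_red t ->
      canon_count (head_red t) (canon r) * mult r = mult t) -> diff_mult head_red_nil t.
    by move=> _ tP [|u us] _ r1 // r1P; rewrite mult_bag_nil muln1; apply: tP.
  move=> rP; rewrite -[RHS]muln1 -mult_bag_nil; apply: diff_app_mult rP => //.
  + exact/head_red_nil_coh/head_red_coh.
  + by apply: nil_mult => // r1; apply: IHs.
  + by move=> s' ss'; apply: head_red_nil_canon => f; apply: head_red_canon.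
  + by move=> t t' tP t'P; apply/head_red_nil_coh/head_red_coh/tts'.
  + by move=> t _ t' tt'; apply: head_red_nil_canon => f; apply: head_red_canon.
  + move=> us r' uu r'P; apply: diff_bag_mult => //.
    * by move=> t tP; apply: nil_mult; [exact: tts'|move=> r1; apply: IHts => //; exact: tts'].
    * by move=> t t' tP t'P; apply/head_red_nil_coh/head_red_coh/tts'.
    * by move=> t _ t' tt'; apply: head_red_nil_canon => f; apply: head_red_canon.
- move=> /mapP[r1 r1P ->]; rewrite (canon_count_map (h := Inl)) // => [|a b [] //].
  by rewrite /= IH //; exact: coh_InlP.
- move=> /mapP[r1 r1P ->]; rewrite (canon_count_map (h := Inr)) // => [|a b [] //].
  by rewrite /= IH //; exact: coh_InrP.
Qed.

(** * Coefficients of normal forms *)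

Lemma meas_canon t : meas (canon t) = meas t.
Proof.
elim/rterm_ind_in: t => //=; rewrite /meas /=.
- by move=> s [-> -> ->].
- move=> s ts [-> -> ->] IH.
  have sumE (m : rterm -> nat) : (forall t, t \in ts -> m (canon t) = m t) ->
      sumn (map m (canon_bag (map canon ts))) = sumn (map m ts).
    move=> mE; rewrite -(perm_sumn (perm_map m (perm_canon_bag _))) -map_comp.
    by congr sumn; apply/eq_in_map.
  by rewrite !sumE // => t /IH[].
- by move=> s [-> -> ->].
- by move=> s [-> -> ->].
Qed.

Lemma decrxx m : decr m m = false.
Proof. by rewrite /decr !ltnn !andbF. Qed.

Lemma mult_gt0 t : 0 < mult t.
Proof.
elim/rterm_ind_in: t => //= s ts s0 IH; rewrite muln_gt0 s0 /= /mult_pairs.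
rewrite big_seq; elim/big_ind: _ => // [m n m0 n0|p].
  by rewrite muln_gt0 m0.
rewrite mem_undup => /mapP[t /IH t0 ->].
by rewrite muln_gt0 fact_gt0 expn_gt0 t0.
Qed.

Lemma sum_neq0 (T : eqType) (s : seq T) (g : T -> nat) :
  \sum_(x <- s) g x != 0 -> exists2 x, x \in s & g x != 0.
Proof.
move=> s0; have [/hasP[x xs gx]|/hasPn sN] := boolP (has (fun x => g x != 0) s).
  by exists x.
case/eqP: s0; rewrite big_seq big1 // => x /sN; by rewrite negbK => /eqP.
Qed.

Section Coefficient.

Variables (c : rterm) (g : rterm -> nat).
Hypothesis g_inv : forall t, step_inv g t.
Hypothesis g_normal : forall t, (forall T, ~ step t T) -> g t = (canon t == c).

(** The steps defining [g] act on lists, but [g] can be computed along [head_red], which respects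
    permutations. *)
Lemma step_inv_canon t t' : canon t = canon t' -> g t = g t'.
Proof.
move: {2}(meas t) (erefl (meas t)) => m.
elim: m / (decr_wf m) t t' => m _ IH t t' tm tt'.
have mt : meas t = meas t' by rewrite -meas_canon tt' meas_canon.
(* Some reduct of [u'] would equal [u] up to permutations, and so have the measure of [u'] instead
   of a smaller one. *)
have nrm u u' : head_red u = [:: u] -> canon u = canon u' -> meas u = meas u' ->
    ~ (forall r, r \in head_red u' -> decr (meas r) (meas u')).
  move=> uE uu' mu u'D.
  have := head_red_canon (fun c => (c == canon u) : nat) uu'.
  rewrite uE big_seq1 eqxx => /esym s1.
  have [|r /u'D + ru] := @sum_neq0 _ (head_red u') (fun r => canon r == canon u).
    by rewrite s1.
  have rE : canon r = canon u by apply/eqP; move: ru => /=; case: (canon r == canon u).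
  by rewrite -meas_canon rE meas_canon mu decrxx.
have [[tE tN]|tD] := head_red_decr t; have [[t'E t'N]|t'D] := head_red_decr t'.
- by rewrite !g_normal // tt'.
- by case: (nrm t t').
- by case: (nrm t' t).
have gE u (uD : forall r, r \in head_red u -> decr (meas r) m) :
    g u = \sum_(r <- head_red u) g (canon r).
  rewrite -{1}(sum_head_red u g_inv); apply: eq_big_seq => r /uD rm.
  by apply: IH rm _ _ _ _; rewrite ?canonK.
by rewrite !gE -?tm ?mt //; [exact: head_red_canon|rewrite -mt].
Qed.

(** Both terms have a reduct on which [g] is nonzero. These reducts are coherent, hence equal by
    induction, and a reduct determines its origin. *)
Lemma coh_step_inv_inj t t' : coh t t' -> g t != 0 -> g t' != 0 -> canon t = canon t'.
Proof.
move: {2}(meas t) (erefl (meas t)) => m.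
elim: m / (decr_wf m) t t' => m _ IH t t' tm.
(* The inner induction serves when [t] is already normal and only [t'] decreases. *)
move: {2}(meas t') (erefl (meas t')) => m'.
elim: m' / (decr_wf m') t' => m' _ IH' t' tm' tt' gt gt'.
have gE u : g u != 0 -> exists2 r, r \in head_red u & g r != 0.
  by rewrite -{1}(sum_head_red u g_inv) => /sum_neq0.
have [r rP gr] := gE t gt; have [r' r'P gr'] := gE t' gt'.
have [rr' inj] := head_red_coh tt' rP r'P.
have [[tE tN]|tD] := head_red_decr t; last first.
  by apply: inj; apply: (IH (meas r)) => //; rewrite -tm; apply: tD.
have [[t'E t'N]|t'D] := head_red_decr t'.
  move: gt gt'; rewrite !g_normal //.
  by case: (canon t =P c) => // ->; case: (canon t' =P c) => // ->.
have rt : r = t by move: rP; rewrite tE inE => /eqP.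
apply: inj; rewrite rt in rr' *.
by apply: (IH' (meas r')) => //; rewrite -tm'; apply: t'D.
Qed.

(** The reducts of [t] on which [g] is nonzero are all equal to one [r0], so [g t] is the
    coefficient of [r0] times [g r0], and the multiplicity of [r0] cancels. *)
Lemma step_inv_mult t : coh t t -> g t != 0 -> g t * mult c = mult t.
Proof.
move: {2}(meas t) (erefl (meas t)) => m.
elim: m / (decr_wf m) t => m _ IH t tm tt gt.
have [[tE tN]|tD] := head_red_decr t.
  move: gt; rewrite g_normal //; case: (canon t =P c) => // <- _.
  by rewrite mult_canon mul1n.
have := gt; rewrite -{1}(sum_head_red t g_inv) => /sum_neq0[r0 r0P gr0].
have gE : g t = canon_count (head_red t) (canon r0) * g r0.
  rewrite -{1}(sum_head_red t g_inv) /canon_count big_distrl /=.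
  apply: eq_big_seq => r rP; case: eqP => [/step_inv_canon ->|rr0].
    by rewrite mul1n.
  apply/eqP/negPn/negP => gr; apply: rr0.
  by apply: coh_step_inv_inj => //; have [] := head_red_coh tt rP r0P.
rewrite gE -mulnA (IH (meas r0)) //; last first.
- by have [] := head_red_coh tt r0P r0P.
- by rewrite -tm; apply: tD.
exact: head_red_mult.
Qed.

End Coefficient.

(* A monomial is handled as the list of arguments of a variable.              *)
Definition term_of (e : rexpr) : rterm :=
  match e with ETerm t => t | EBag ts => App (Var 0) ts end.

Definition is_term (e : rexpr) : bool := if e is ETerm _ then true else false.

Lemma step_expr_term e E : step_expr e E -> step (term_of e) (map term_of E).
Proof.
case=> [t T tT|ts T tsT]; first by rewrite -map_comp map_id.
by rewrite -map_comp; apply: step_App_r.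
Qed.

Lemma step_termP e T : step (term_of e) T -> exists E, step_expr e E.
Proof.
case: e => [t tT|ts /step_AppP[|[S /step_VarP]|[T' tsT' _]]] //.
  by eexists; apply: step_ETerm tT.
by eexists; apply: step_EBag tsT'.
Qed.

Lemma step_expr_is_term e E x : step_expr e E -> x \in E -> is_term x = is_term e.
Proof. by case=> [t T _|ts T _] /mapP[y _ ->]. Qed.

Lemma steps_sum (g : rterm -> nat) E F : (forall t, step_inv g t) -> steps E F ->
  \sum_(e <- E) g (term_of e) = \sum_(e <- F) g (term_of e).
Proof.
move=> gP; elim=> [{}E {}F|//|E1 E2 E3 _ -> _ ->] //.
case=> F1 e F2 G /step_expr_term eG.
by rewrite !big_cat big_cons (gP _ _ eG) big_map.
Qed.

Lemma steps_is_term b E F : steps E F ->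
  all (fun e => is_term e == b) E -> all (fun e => is_term e == b) F.
Proof.
elim=> [{}E {}F|//|E1 E2 E3 _ IH1 _ IH2 /IH1/IH2 //].
case=> F1 e F2 G eG; rewrite !all_cat /= => /and3P[-> eb ->]; rewrite andbT.
by apply/allP => x /(step_expr_is_term eG) ->.
Qed.

Lemma canon_term_of e e' : is_term e = is_term e' ->
  (canon_expr e == canon_expr e') = (canon (term_of e) == canon (term_of e')).
Proof.
by case: e e' => [t|ts] [t'|ts'] //= _; apply/eqP/eqP => [[->]|[->]].
Qed.

Lemma canon_expr_is_term e e' : canon_expr e = canon_expr e' -> is_term e = is_term e'.
Proof. by case: e; case: e'. Qed.

Lemma mult_term_of e : mult (term_of e) = mult_expr e.
Proof. by case: e => //= ts; rewrite mul1n. Qed.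

Lemma coh_term_of e e' : coh_expr e e' -> coh (term_of e) (term_of e').
Proof. by case=> //= ts ts' tts; apply: coh_App => //; apply: coh_Var. Qed.

Theorem theorem6p9 (e e' : rexpr) (he : coh_expr e e)
    (he' : e' \in supp (NF [:: e])) :
  ((coeff (NF [:: e]) e')%:R = (mult_expr e)%:R / (mult_expr e')%:R :> rat)%R.
Proof.
have [NF_steps /normalP NF_normal] := NFP [:: e].
set F := NF [:: e] in he' NF_steps NF_normal *.
(* [term_of] identifies a monomial with a term; this is harmless as reduction never mixes the two
   kinds. *)
have F_kind : all (fun x => is_term x == is_term e) F.
  by apply: steps_is_term NF_steps _; rewrite /= eqxx.
have coeffE : coeff F e' = \sum_(x <- F) (canon_expr x == canon_expr e').
  by rewrite /coeff count_map -sum1_count big_mkcond.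
have e'_kind : is_term e' = is_term e.
  have := he'; rewrite inE /= coeffE => /sum_neq0[x xF].
  case: (canon_expr x =P _) => // /canon_expr_is_term <- _.
  by apply/eqP; apply: (allP F_kind).
have [g g_inv g_normal] := exists_step_inv (fun t => canon t == canon (term_of e')).
have gE : g (term_of e) = coeff F e'.
  have := steps_sum g_inv NF_steps; rewrite big_seq1 => ->.
  rewrite coeffE; apply: eq_big_seq => x xF; rewrite canon_term_of; last first.
    by rewrite e'_kind; apply/eqP; apply: (allP F_kind).
  by apply: g_normal => T /step_termP[E]; apply: NF_normal.
have := step_inv_mult g_inv g_normal (coh_term_of he).
rewrite gE mult_canon !mult_term_of => /(_ he') <-.
rewrite GRing.natrM GRing.mulfK // Num.Theory.pnatr_eq0 -lt0n -mult_term_of.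
exact: mult_gt0.
Qed.
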